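(* Let $S$ be a connected closed oriented surface and let $D$ be a link diagram on $S$ which admits a source-sink structure. Then the map $d_h\colon [[D]]\to[[D]]$ defined in the context satisfies $d_h\circ d_h=0$, i.e. $([[D]],d_h)$ is a chain complex.
   Context: Throughout, $S$ is a connected closed oriented surface and all vector spaces are over $\mathbb Z_2$. Links in the thickening $S\times[0,1]$ are represented by diagrams on $S$: 4-valent graphs embedded in $S$, possibly together with closed components that have no vertices, with over/under-crossing information at each vertex (crossing). Two diagrams represent isotopic links if and only if they are related by isotopies of $S$ and Reidemeister moves. A source-sink structure on a diagram $D$ is an orientation of the edges of $D$, viewed as a 4-valent graph, such that at each crossing the two incoming edges are opposite to each other and the two outgoing edges are opposite to each other. Let $\mathfrak L$ be the set of free homotopy classes of oriented loops $S^1\to S$, and let $\bigcirc\in\mathfrak L$ be the class of contractible loops. Let $\mathfrak H$ be the quotient of the free abelian group on $\mathfrak L$ by the relations $\bigcirc=0$ and $[\gamma]=[-\gamma]$ for every loop $\gamma$, where $-\gamma$ is $\gamma$ with reversed orientation. Every unoriented closed curve $C$ in $S$ therefore has a class $[C]\in\mathfrak H$. Call $C$ trivial if it is contractible, i.e. its homotopy class is $\bigcirc$, and nontrivial otherwise. Let $\mathcal X(D)$ be the set of crossings of $D$. Each crossing has two smoothings, the $0$-resolution and the $1$-resolution (Kauffman's $A$- and $B$-smoothings). A state is a map $s\colon\mathcal X(D)\to\{0,1\}$. The resolution $D_s$ obtained by smoothing every crossing according to $s$ is a finite set of disjoint simple closed curves (circles) in $S$. Let $\beta(s)$ be the number of $1$'s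 in $s$. The states are the vertices of the cube $\{0,1\}^{\mathcal X(D)}$. An edge $e=s\to s'$ of this cube joins two states that differ only at one crossing $c$, with $s(c)=0$ and $s'(c)=1$. Passing from $D_s$ to $D_{s'}$ has one of three effects: two circles merge into one, one circle splits into two, or one circle turns into one circle. The third case does not occur when $D$ admits a source-sink structure. Circles away from $c$ correspond identically. Let $V$ be the $\mathbb Z_2$-vector space with basis $v_+,v_-$, where $\deg v_\pm=\pm1$. For a state $s$, set $V(s)=\bigotimes_{C\in D_s}V$, with one tensor factor for each circle of $D_s$, and set $[[D]]=\bigoplus_s V(s)$. For a basis element $x=\bigotimes_C x_C\in V(s)$ with $x_C\in\{v_+,v_-\}$ define: - the homological grading $\beta(x)=\beta(s)$; - the quantum grading $q(x)=\sum_C\deg(x_C)+\beta(s)$; - the homotopical grading $h(x)=\sum_C \deg(x_C)[C]\in\mathfrak H$. Define linear maps $m,m^0_h,m^1_h,m^2_h\colon V\otimes V\to V$ by - $m(v_+\otimes v_+)=v_+$, $m(v_+\otimes v_-)=m(v_-\otimes v_+)=v_-$, $m(v_-\otimes v_-)=0$; - $m^0_h(v_+\otimes v_-)=m^0_h(v_-\otimes v_+)=v_-$, $m^0_h(v_+\otimes v_+)=m^0_h(v_-\otimes v_-)=0$; - $m^1_h(v_+\otimes v_+)=v_+$, $m^1_h(v_-\otimes v_+)=v_-$, $m^1_h(v_+\otimes v_-)=m^1_h(v_-\otimes v_-)=0$; - $m^2_h(v_+\otimes v_+)=v_+$, $m^2_h(v_+\otimes v_-)=v_-$, $m^2_h(v_-\otimes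 v_+)=m^2_h(v_-\otimes v_-)=0$. Define linear maps $\Delta,\Delta^0_h,\Delta^1_h,\Delta^2_h\colon V\to V\otimes V$ by - $\Delta(v_+)=v_+\otimes v_-+v_-\otimes v_+$, $\Delta(v_-)=v_-\otimes v_-$; - $\Delta^0_h(v_+)=v_+\otimes v_-+v_-\otimes v_+$, $\Delta^0_h(v_-)=0$; - $\Delta^1_h(v_+)=v_+\otimes v_-$, $\Delta^1_h(v_-)=v_-\otimes v_-$; - $\Delta^2_h(v_+)=v_-\otimes v_+$, $\Delta^2_h(v_-)=v_-\otimes v_-$. For a merge of circles $\gamma_1,\gamma_2$ (first and second tensor factor) into $\gamma$, let $m_h$ be: - $m$ if $\gamma_1,\gamma_2,\gamma$ are all trivial; - $m^1_h$ if $\gamma_2$ is trivial and $\gamma_1,\gamma$ are nontrivial; - $m^2_h$ if $\gamma_1$ is trivial and $\gamma_2,\gamma$ are nontrivial; - $m^0_h$ if $\gamma$ is trivial and $\gamma_1,\gamma_2$ are nontrivial; - $0$ if $\gamma_1,\gamma_2,\gamma$ are all nontrivial. For a split of $\gamma$ into $\gamma_1,\gamma_2$, define $\Delta_h$ analogously, using $\Delta,\Delta^1_h,\Delta^2_h,\Delta^0_h,0$ respectively in the same five cases. These cases exhaust all possibilities. For an edge $e=s\to s'$, the partial map $(\partial_e)_h\colon V(s)\to V(s')$ is: - $m_h$ on the two factors of the merging circles tensored with the identity on the other factors, if two circles merge; - $\Delta_h$ on the factor of the splitting circle tensored with the identity on the other factors, if a circle splits; - $0$ if one circle turns into one circle.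 Finally set $d_h=\sum_e(\partial_e)_h$, summed over all edges of the cube. This $d_h$ is exactly the part of the usual Khovanov differential $d$ (the same construction using $m$ and $\Delta$ in all cases) that preserves the homotopical grading. *)

(* Defs.v *)
From Stdlib Require Import Relations ClassicalEpsilon.
From HB Require Import structures.
From mathcomp Require Import all_boot all_order all_algebra all_fingroup.
Set Implicit Arguments. Unset Strict Implicit. Unset Printing Implicit Defensive.
Import GRing.Theory.

Section KhovanovHomotopical.

(* ---------- The surface S, given as a combinatorial map (ribbon graph) ----------
   Darts T; sg = counterclockwise rotation of darts around their vertex
   (vertices = sg-orbits); al = fixed-point-free involution exchanging the two
   darts of an edge.  A dart d is the edge oriented from its vertex to the
   vertex of (al d).  Faces = orbits of (fun d => sg (al d)).
   Gluing a disc along every face gives a closed oriented surface S. *)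
Variables (T : finType) (sg al : {perm T}).

Definition sgf (d : T) : T := sg d.
Definition alf (d : T) : T := al d.

Definition is_surface_map : Prop :=
  [/\ 0 < #|T|,
      (forall d, al (al d) = d),
      (forall d, al d != d) &
      (forall d e, connect (fun x y => (y == sg x) || (y == al x)) d e)].

(* ---------- Free homotopy: contractibility of closed walks ----------
   pi_1 of the 2-complex: words in darts, with relations  d (al d) = 1
   (backtracking) and  (boundary word of a face) = 1. *)
Definition faceword (d : T) : seq T := fingraph.orbit (fun y => sg (al y)) d.

Inductive hstep : seq T -> seq T -> Prop :=
| hstep_back (w1 w2 : seq T) (d : T) :
    hstep (w1 ++ w2) (w1 ++ [:: d; al d] ++ w2)
| hstep_face (w1 w2 : seq T) (d : T) :
    hstep (w1 ++ w2) (w1 ++ faceword d ++ w2).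

Definition contractible (w : seq T) : Prop :=
  clos_refl_sym_trans (seq T) hstep w [::].

(* ---------- The link diagram D on S ----------
   Dd = set of darts lying on D (D is a subgraph of the 1-skeleton; every
   vertex of the map has 0, 2 or 4 darts of D; vertices with 4 are the
   crossings, those with 2 are interior points of arcs of D).
   Over = darts at crossings belonging to the over-strand. *)
Variables (Dd Over : {set T}).

Definition ddeg (d : T) : nat := #|[pred e | fconnect sgf d e && (e \in Dd)]|.
Definition iscross (d : T) : bool := ddeg d == 4.

Definition nextD (d : T) : T :=
  let t := traject sgf (sg d) #|T| in nth d t (find (fun e => e \in Dd) t).
Definition prevD (d : T) : T :=
  let si := (sg^-1)%g in
  let t := traject (fun e => si e) (si d) #|T| in
  nth d t (find (fun e => e \in Dd) t).
Definition oppD (d : T) : T := nextD (nextD d).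

Definition is_diagram : Prop :=
  [/\ (forall d, (d \in Dd) = (al d \in Dd)),
      (forall d, ddeg d \in [:: 0; 2; 4]) &
      (forall d, d \in Dd -> iscross d ->
         ((d \in Over) = (oppD d \in Over)) /\ ((d \in Over) != (nextD d \in Over)))].

(* source-sink structure: an orientation of the edges of D (Out = darts of D
   pointing forward), consistent along arcs of D through 2-valent points,
   with the two incoming resp. two outgoing edges opposite at each crossing. *)
Definition source_sink (Out : {set T}) : Prop :=
  [/\ Out \subset Dd,
      (forall d, d \in Dd -> (d \in Out) != (al d \in Out)),
      (forall d, d \in Dd -> ddeg d = 2 -> (d \in Out) != (nextD d \in Out)) &
      (forall d, d \in Dd -> iscross d ->
         ((d \in Out) = (oppD d \in Out)) /\ ((d \in Out) != (nextD d \in Out)))].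

Definition admits_source_sink : Prop := exists Out, source_sink Out.

Definition crossing := {v : T | (froot sgf v == v) && iscross v}.
Definition state := {ffun crossing -> bool}.

Definition sv (s : state) (d : T) : bool :=
  if (insub (froot sgf d) : option crossing) is Some c then s c else false.

(* In D_s, the dart d of D (leaving its vertex) is joined through the vertex to
   the dart  pairD s d.  At a crossing the 0-resolution (Kauffman A-smoothing)
   joins each under-dart u with nextD u (the arcs bound the B-quadrants),
   the 1-resolution joins each under-dart u with prevD u. *)
Definition pairD (s : state) (d : T) : T :=
  if iscross d then (if addb (d \in Over) (sv s d) then prevD d else nextD d)
  else nextD d.

(* circles of D_s = connected components of this relation on the darts of D *)
Definition crel (s : state) : rel T :=
  fun d e => [&& d \in Dd, e \in Dd & (e == al d) || (e == pairD s d)].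

Definition phi (s : state) (d : T) : T := pairD s (al d).
Definition circle_walk (s : state) (d : T) : seq T := fingraph.orbit (phi s) d.

Definition trivb (s : state) (d : T) : bool :=
  if excluded_middle_informative (contractible (circle_walk s d)) then true
  else false.

(* ---------- The chain group [[D]] ----------
   A basis element is a state s together with a labelling of the circles of
   D_s by v_+ (true) / v_- (false), encoded as a labelling of the darts of D
   constant on circles (and false off D). *)
Definition label := {ffun T -> bool}.
Definition validg (p : state * label) : bool :=
  [forall d, forall e, crel p.1 d e ==> (p.2 d == p.2 e)] &&
  [forall d, (d \notin Dd) ==> ~~ p.2 d].
Definition gen := {p : state * label | validg p}.

(* ---------- The algebraic maps, as matrix coefficients ----------
   mX a1 a2 b = coefficient of v_b in mX(v_a1 (x) v_a2);
   DX a b1 b2 = coefficient of v_b1 (x) v_b2 in DX(v_a). (true = v_+) *)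
Definition m_c (a1 a2 b : bool) : bool :=
  match a1, a2 with
  | true, true => b | true, false => ~~ b | false, true => ~~ b
  | false, false => false end.
Definition m0_c (a1 a2 b : bool) : bool :=
  match a1, a2 with
  | true, false => ~~ b | false, true => ~~ b | _, _ => false end.
Definition m1_c (a1 a2 b : bool) : bool :=
  match a1, a2 with
  | true, true => b | false, true => ~~ b | _, _ => false end.
Definition m2_c (a1 a2 b : bool) : bool :=
  match a1, a2 with
  | true, true => b | true, false => ~~ b | _, _ => false end.
Definition D_c (a b1 b2 : bool) : bool :=
  if a then addb b1 b2 else ~~ b1 && ~~ b2.
Definition D0_c (a b1 b2 : bool) : bool :=
  if a then addb b1 b2 else false.
Definition D1_c (a b1 b2 : bool) : bool :=
  if a then b1 && ~~ b2 else ~~ b1 && ~~ b2.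
Definition D2_c (a b1 b2 : bool) : bool :=
  if a then ~~ b1 && b2 else ~~ b1 && ~~ b2.

(* t1 t2 t: triviality of gamma1, gamma2, gamma (true = trivial).
   Combinations not listed in the paper cannot occur; they get 0. *)
Definition mh_c (t1 t2 t : bool) : bool -> bool -> bool -> bool :=
  if [&& t1, t2 & t] then m_c
  else if [&& ~~ t1, t2 & ~~ t] then m1_c
  else if [&& t1, ~~ t2 & ~~ t] then m2_c
  else if [&& ~~ t1, ~~ t2 & t] then m0_c
  else fun _ _ _ => false.
Definition Dh_c (t t1 t2 : bool) : bool -> bool -> bool -> bool :=
  if [&& t1, t2 & t] then D_c
  else if [&& ~~ t1, t2 & ~~ t] then D1_c
  else if [&& t1, ~~ t2 & ~~ t] then D2_c
  else if [&& ~~ t1, ~~ t2 & t] then D0_c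
  else fun _ _ _ => false.

Definition cube_edge (c : crossing) (s s' : state) : bool :=
  (s c == false) && (s' == [ffun c' => if c' == c then true else s c']).

Definition atc (c : crossing) (d : T) : bool := (froot sgf d == val c) && (d \in Dd).
Definition cdart (c : crossing) : T := odflt (val c) [pick e | atc c e].
Definition other (s : state) (c : crossing) : option T :=
  [pick e | atc c e & ~~ connect (crel s) (cdart c) e].

Definition pcoef (c : crossing) (g g' : gen) : bool :=
  let s := (val g).1 in let x := (val g).2 in
  let s' := (val g').1 in let x' := (val g').2 in
  let d1 := cdart c in
  cube_edge c s s' &&
  (* circles away from c correspond identically (labels preserved) *)
  [forall d, ~~ [exists e, atc c e && connect (crel s) e d] ==> (x d == x' d)] &&
  match other s c, other s' c with
  | Some e2, None =>   (* merge: gamma1 (through d1), gamma2 (through e2) -> gamma *)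
      mh_c (trivb s d1) (trivb s e2) (trivb s' d1) (x d1) (x e2) (x' d1)
  | None, Some e2 =>   (* split: gamma -> gamma1 (through d1), gamma2 (through e2) *)
      Dh_c (trivb s d1) (trivb s' d1) (trivb s' e2) (x d1) (x' d1) (x' e2)
  | _, _ => false      (* one circle turns into one circle *)
  end.

Definition chain := {ffun gen -> 'F_2}.
Definition dh (f : chain) : chain :=
  [ffun g' => (\sum_(c : crossing) \sum_(g : gen) (pcoef c g g')%:R * f g)%R].

End KhovanovHomotopical.

(* Main.v *)
Require Import Defs.
From Stdlib Require Import Relations ClassicalEpsilon.
From HB Require Import structures.
From mathcomp Require Import all_boot all_order all_algebra all_fingroup.
From mathcomp Require Import lra.

(* A source-sink structure orients all circles of all resolutions coherently:
   on outgoing darts the circles of D_s are the cycles of a permutation, and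
   changing the smoothing of a crossing composes it with the transposition of
   the two outgoing darts there. Hence every cube edge is a merge or a split.

   The full Khovanov maps square to zero: V(s) is the quotient of
   R = F_2[X_d]/(X_d^2) by X_d = X_e for d, e on a common circle, merges are
   quotient maps and splits are multiplication by X_a + X_b, where a, b are the
   outgoing darts at the crossing. All maps being R-linear, a square of the cube
   commutes as soon as the images of 1 agree.

   Let tau be the sum of the degrees of the labels over the nontrivial circles.
   As two of the circles involved in a merge or split being contractible forces
   the third to be, the full differential never increases tau, and d_h is its
   tau-preserving part; so d_h o d_h is the tau-preserving part of 0. *)

Set Implicit Arguments. Unset Strict Implicit. Unset Printing Implicit Defensive.
Import GRing.Theory Num.Theory.

(** * Free homotopy of closed walks *)

Section Words.
Variables (T : finType) (sg al : {perm T}).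

Local Notation eqw := (clos_refl_sym_trans (seq T) (hstep sg al)).
Local Notation contr := (contractible sg al).

Lemma eqw_cat u v w1 w2 : eqw u v -> eqw (w1 ++ u ++ w2) (w1 ++ v ++ w2).
Proof.
elim=> [x y|x|x y _ IH|x y z _ IHxy _ IHyz].
- case=> a b d; apply: rst_step.
    by have := hstep_back sg al (w1 ++ a) (b ++ w2) d; rewrite -!catA.
  by have := hstep_face sg al (w1 ++ a) (b ++ w2) d; rewrite -!catA.
- exact: rst_refl.
- exact: rst_sym.
- exact: rst_trans IHxy IHyz.
Qed.

Lemma eqw_contractible u v : eqw u v -> contr u -> contr v.
Proof. by move=> uv; apply: rst_trans; apply: rst_sym. Qed.

Lemma contractible_catl u v : contr u -> (contr (u ++ v) <-> contr v).
Proof.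
move=> cu; have e : eqw (u ++ v) v by apply: (eqw_cat [::] v cu).
by split; apply: eqw_contractible => //; apply: rst_sym.
Qed.

Lemma contractible_catr u v : contr v -> (contr (u ++ v) <-> contr u).
Proof.
move=> cv; have e : eqw (u ++ v) u by have := eqw_cat u [::] cv; rewrite !cats0.
by split; apply: eqw_contractible => //; apply: rst_sym.
Qed.

Definition winv (w : seq T) := rev (map al w).

Lemma winv_cons d w : winv (d :: w) = winv w ++ [:: al d].
Proof. by rewrite /winv /= rev_cons cats1. Qed.

Lemma eqw_catV w : eqw (w ++ winv w) [::].
Proof.
elim: w => [|d w IH]; first exact: rst_refl.
rewrite winv_cons.
have e : eqw ([:: d] ++ (w ++ winv w) ++ [:: al d]) [:: d; al d].
  exact: (eqw_cat [:: d] [:: al d] IH).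
rewrite /= -catA in e; apply: rst_trans e _; apply: rst_sym; apply: rst_step.
exact: (hstep_back sg al [::] [::] d).
Qed.

Lemma contractible_winv w : contr w -> contr (winv w).
Proof. by move=> cw; apply/(contractible_catl _ cw); apply: eqw_catV. Qed.

(** [v ++ u] is equivalent to the conjugate [v ++ (u ++ v) ++ winv v], whose middle contracts and
    whose remainder backtracks. *)
Lemma contractible_catC u v : contr (u ++ v) -> contr (v ++ u).
Proof.
move=> cuv; have e := eqw_cat v (winv v) cuv; rewrite -!catA in e.
have e' := eqw_cat (v ++ u) [::] (eqw_catV v).
rewrite !cats0 -!catA in e'.
apply: (rst_trans _ _ _ _ _ (rst_sym _ _ _ _ e')).
exact: (rst_trans _ _ _ _ _ e (eqw_catV v)).
Qed.

(** Moving the base point along a closed walk only conjugates it, so a circle may be read from any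
    of its darts. *)
Lemma contractible_rot n w : contr (rot n w) <-> contr w.
Proof.
have H m v : contr v -> contr (rot m v).
  by rewrite -{1}(cat_take_drop m v) => /contractible_catC.
by split; [rewrite -{2}(rotK n w); apply: H | apply: H].
Qed.

End Words.

(** * Cutting and joining cycles of a map *)

Section Surgery.
(** Here [g] is [f] followed by the transposition of [a] and [b]. The surgery is carried out with
    [S] the outgoing darts, on which a change of smoothing has this form. *)
Variables (T : finType) (S : {pred T}) (f g : T -> T) (a b : T).
Hypotheses (fS : {homo f : x / x \in S}) (f_inj : {in S &, injective f}).
Hypotheses (aS : a \in S) (bS : b \in S).
Hypothesis gE : {in S, forall x,
  g x = if f x == a then b else if f x == b then a else f x}.

Local Notation orb := fingraph.orbit.

(** The transposition is an involution, so [f] and [g] can be exchanged; this lets a split be read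
    as a merge backwards. *)
Lemma surgery_sym : {in S, forall x,
  f x = if g x == a then b else if g x == b then a else g x}.
Proof.
move=> x xS; rewrite gE //.
by case: (f x =P a) => xa; case: (f x =P b) => xb; do 2?case: eqP; congruence.
Qed.

Lemma orbit_sub x : x \in S -> {subset orb f x <= S}.
Proof. by move=> xS y /trajectP[i _ ->]; apply: iter_in. Qed.

Lemma orbit_cons x : orb f x = x :: behead (orb f x).
Proof. by rewrite /orb -orderSpred. Qed.

Lemma cycle_orbitS x : x \in S -> fcycle f (orb f x).
Proof. by move=> xS; apply: (cycle_orbit_in fS f_inj). Qed.

Lemma mem_orbitC x y : x \in S -> y \in S -> (y \in orb f x) = (x \in orb f y).
Proof.
by move=> xS yS; rewrite -!fconnect_orbit (fconnect_sym_in fS f_inj).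
Qed.

Lemma surgery_path x p : {subset x :: p <= S} -> a \notin p -> b \notin p ->
  fpath f x p -> fpath g x p.
Proof.
elim: p x => //= y p IH x sub; rewrite !inE !negb_or eq_sym => /andP[ya ap].
rewrite eq_sym => /andP[yb bp] /andP[/eqP fx fp].
rewrite gE ?fx; last by apply: sub; rewrite inE eqxx.
rewrite (negPf ya) (negPf yb) eqxx; apply: IH => // z zp.
by apply: sub; rewrite inE zp orbT.
Qed.

(** Only the last elements of the two orbits, the [f]-preimages of [a] and [b], change their images,
    and they exchange them. The equality is one of sequences, since contractibility is read off the
    concatenated walk. *)
Lemma surgery_merge_orbit : b \notin orb f a -> orb g a = orb f a ++ orb f b.
Proof.
move=> ba.
have ab : a \notin orb f b by rewrite mem_orbitC.
have Ua := orbit_uniq f a; have Ub := orbit_uniq f b.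
have sa := orbit_sub aS; have sb := orbit_sub bS.
have ca := cycle_orbitS aS; have cb := cycle_orbitS bS.
have dis : ~~ has (mem (orb f a)) (orb f b).
  apply/hasPn => x xb; apply/negP => /= xa; case/negP: ba.
  move: xb xa; rewrite -!fconnect_orbit => xb xa; apply: connect_trans xa _.
  by rewrite (fconnect_sym_in fS f_inj) // sb // -fconnect_orbit.
move: Ua Ub sa sb ca cb ba ab dis; rewrite (orbit_cons a) (orbit_cons b).
move: (behead _) (behead _) => q p Ua Ub sa sb ca cb ba ab dis.
have U : uniq ((a :: p) ++ b :: q) by rewrite cat_uniq Ua Ub dis.
have [ap ub] := andP Ua; have [bq _] := andP Ub.
have bp : b \notin p by apply: contra ba; rewrite inE orbC => ->.
have aq : a \notin q by apply: contra ab; rewrite inE orbC => ->.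
have C : fcycle g ((a :: p) ++ b :: q).
  move: ca cb; rewrite /= rcons_cat rcons_cons cat_path /= !rcons_path.
  case/andP=> pa /eqP la /andP[pb /eqP lb].
  have lap : last a p \in S by apply/sa/mem_last.
  have lbq : last b q \in S by apply/sb/mem_last.
  rewrite !surgery_path //= (gE lap) (gE lbq) la lb !eqxx /=.
  by case: ifP => [/eqP->|_]; rewrite eqxx.
by rewrite (fingraph.orbitE C U) ?mem_head //= eqxx rot0.
Qed.

(** Cut the orbit of [a] just before [b]: the element preceding [b] is now sent to [a], so the
    initial piece closes up into a [g]-cycle without [b]. *)
Lemma surgery_split_notin : a != b -> b \in orb f a -> b \notin orb g a.
Proof.
move=> ab ba.
have Ua := orbit_uniq f a; have sa := orbit_sub aS; have ca := cycle_orbitS aS.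
move: ba; rewrite orbit_cons inE eq_sym (negPf ab) /= => bin.
move: Ua sa ca; rewrite orbit_cons; case/splitPr: bin => p q Ua sa ca.
have Ua' : uniq ((a :: p) ++ b :: q) by [].
have bp : b \notin a :: p.
  by move: Ua'; rewrite cat_uniq => /and3P[_ /hasPn H _]; apply: H; rewrite mem_head.
have Up : uniq (a :: p) by move: Ua'; rewrite cat_uniq => /and3P[].
have C : fcycle g (a :: p).
  move: ca; rewrite /= rcons_cat cat_path /= rcons_path => /and3P[pa /eqP la _].
  have sub : {subset a :: p <= S}.
    by move=> x; rewrite inE => xp; apply: sa; rewrite inE mem_cat orbA xp.
  have lap : last a p \in S by apply/sub/mem_last.
  have [ap _] := andP Up.
  have bp' : b \notin p by apply: contra bp; rewrite inE orbC => ->.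
  rewrite /= rcons_path surgery_path //= (gE lap) la eqxx.
  by case: ifP => [/eqP->|_]; rewrite eqxx.
by rewrite (fingraph.orbitE C Up) ?mem_head //= eqxx rot0.
Qed.

Lemma surgery_other x : x \in S -> a \notin orb f x -> b \notin orb f x ->
  orb g x = orb f x.
Proof.
move=> xS; have Ux := orbit_uniq f x; have sx := orbit_sub xS.
have := cycle_orbitS xS; move: Ux sx; rewrite orbit_cons.
move: (behead _) => p U sub C ax bx.
have [ap bp] : a \notin p /\ b \notin p.
  by split; [apply: contra ax | apply: contra bx]; rewrite inE orbC => ->.
have C' : fcycle g (x :: p).
  move: C; rewrite /= !rcons_path => /andP[px /eqP lx].
  have lxS : last x p \in S by apply/sub/mem_last.
  rewrite surgery_path //= (gE lxS) lx.
  move: ax bx; rewrite !inE !negb_or => /andP[/negPf xa _] /andP[/negPf xb _].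
  by rewrite [x == a]eq_sym xa [x == b]eq_sym xb eqxx.
by rewrite (fingraph.orbitE C' U) ?mem_head //= eqxx rot0.
Qed.

End Surgery.

(** * First-return maps *)

Section FirstReturn.
Variables (T : finType) (A : {set T}).

(** [nextD] and [prevD] are convertible to this for the rotation and its inverse, with [A = Dd].
    Searching [#|T|] steps suffices, because [d] in [A] itself recurs when [p] is injective. *)
Definition first_return (p : T -> T) (d : T) : T :=
  let t := traject p (p d) #|T| in nth d t (find (fun e => e \in A) t).

Lemma first_returnP p d : injective p -> d \in A -> exists k,
  [/\ 0 < k, first_return p d = iter k p d, iter k p d \in A &
      forall j, 0 < j -> j < k -> iter j p d \notin A].
Proof.
move=> p_inj dA; rewrite /first_return; set t := traject _ _ _.
have tE j : j < #|T| -> nth d t j = iter j.+1 p d.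
  by move=> lj; rewrite (set_nth_default (p d)) ?size_traject // nth_traject // -iterSr.
have hA : has (fun e => e \in A) t.
  (* This index of [t] holds [d] itself, as [t] starts at [p d]. *)
  apply/(has_nthP d); exists (fingraph.order p d).-1.
    by rewrite size_traject orderSpred max_card.
  by rewrite tE ?orderSpred ?max_card // iter_order.
have lt : find (fun e => e \in A) t < #|T|.
  by move: hA; rewrite has_find size_traject.
exists (find (fun e => e \in A) t).+1; split=> //.
- exact: tE.
- by rewrite -tE //; apply: (nth_find d hA).
move=> [//|j] _ lj; rewrite -tE; last exact: ltn_trans lt.
by rewrite (before_find d lj).
Qed.

Lemma first_return_in p d : injective p -> d \in A -> first_return p d \in A.
Proof. by move=> pI dA; have [k [_ -> ? _]] := first_returnP pI dA. Qed.

Lemma first_return_fconnect p d :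
  injective p -> d \in A -> fconnect p d (first_return p d).
Proof.
move=> pI dA; have [k [_ -> _ _]] := first_returnP pI dA.
exact: fconnect_iter.
Qed.

(** Iterating [q] from the first return retraces the same stretch, whose interior avoids [A]. *)
Lemma first_returnK p q d : cancel p q -> cancel q p -> d \in A ->
  first_return q (first_return p d) = d.
Proof.
move=> pK qK dA; have pI := can_inj pK; have qI := can_inj qK.
have [k [k0 -> kA kmin]] := first_returnP pI dA.
have [l [l0 -> lA lmin]] := first_returnP qI kA.
have it j : j <= k -> iter j q (iter k p d) = iter (k - j) p d.
  elim: j => [|j IH] lj; first by rewrite subn0.
  by rewrite iterS IH ?(ltnW lj) // -[k - j]prednK ?subn_gt0 // iterS pK -subnS.
have lk : l <= k.
  rewrite leqNgt; apply/negP => kl; have := lmin k k0 kl.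
  by rewrite it // subnn dA.
move: lA; rewrite it //; case: (posnP (k - l)) => [-> //|kl lA].
by have := kmin _ kl; rewrite lA ltn_subrL l0 k0 => /(_ isT).
Qed.

Lemma first_return_orbit p d e : injective p -> d \in A -> e \in A ->
  fconnect p d e = fconnect (first_return p) d e.
Proof.
move=> pI dA eA; apply/idP/idP; last first.
  move/iter_findex <-; elim: (findex _ _ _) => //= n IH.
  apply: connect_trans IH _; apply: first_return_fconnect => //.
  by elim: n => //= n; apply: first_return_in.
move/iter_findex=> E; move: eA; rewrite -E {E}; move: (findex _ _ _) => n.
(* Strong induction on the number of steps: the first return uses up at least one of them and cannot
   overshoot a point of [A]. *)
elim/ltn_ind: n d dA => n IH d dA nA.
have [->|n0] := posnP n; first exact: connect0.
have [k [k0 E kA kmin]] := first_returnP pI dA.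
have kn : k <= n by rewrite leqNgt; apply/negP => nk; case/negP: (kmin n n0 nk).
rewrite -(subnK kn) iterD -E; apply: (connect_trans (fconnect1 _ _)).
apply: IH; first by rewrite ltn_subrL k0.
  exact: first_return_in.
by rewrite E -iterD subnK.
Qed.

(** Serves to identify the degree [ddeg] of a vertex in the diagram with the order of [nextD]. *)
Lemma card_first_return p d : injective p -> d \in A ->
  #|[pred e | fconnect p d e && (e \in A)]| = fingraph.order (first_return p) d.
Proof.
move=> pI dA; apply: eq_card => e; rewrite !inE.
case: (boolP (e \in A)) => eA; first by rewrite andbT first_return_orbit.
rewrite andbF; symmetry; apply: contraNF eA => /iter_findex <-.
by elim: (findex _ _ _) => //= n; apply: first_return_in.
Qed.

End FirstReturn.

(** * Circles of the resolutions *)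

Section Diagram.
Variables (T : finType) (sg al : {perm T}) (Dd Over Out : {set T}).
Hypothesis alK : forall d, al (al d) = d.
Hypothesis diagP : is_diagram sg al Dd Over.
Hypothesis outP : source_sink sg al Dd Out.

Local Notation N := (nextD sg Dd).
Local Notation P := (prevD sg Dd).
Local Notation crossing := (crossing sg Dd).
Local Notation state := (state sg Dd).
Local Notation pairD := (@pairD T sg Dd Over).
Local Notation phi := (@phi T sg al Dd Over).
Local Notation crel := (@crel T sg al Dd Over).
Local Notation trivb := (@trivb T sg al Dd Over).
Local Notation orb := fingraph.orbit.
Local Notation vert := (froot (sgf sg)).

Lemma sgf_inj : injective (sgf sg). Proof. exact: perm_inj. Qed.

Lemma al_in d : (al d \in Dd) = (d \in Dd).
Proof. by have [H _ _] := diagP; rewrite -H. Qed.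

Lemma out_in d : d \in Out -> d \in Dd.
Proof. by have [/subsetP H _ _ _] := outP; apply: H. Qed.

Lemma out_al d : d \in Dd -> (al d \in Out) = (d \notin Out).
Proof. by have [_ H _ _] := outP => /H; do 2!case: (_ \in Out). Qed.

Lemma next_in d : d \in Dd -> N d \in Dd.
Proof. exact: (first_return_in sgf_inj). Qed.

Lemma nextK d : d \in Dd -> P (N d) = d.
Proof. exact: (first_returnK (permK sg) (permKV sg)). Qed.

Lemma prevK d : d \in Dd -> N (P d) = d.
Proof. exact: (first_returnK (permKV sg) (permK sg)). Qed.

Lemma prev_in d : d \in Dd -> P d \in Dd.
Proof. exact: (first_return_in (@perm_inj _ sg^-1)). Qed.

Lemma vert_next d : d \in Dd -> vert (N d) = vert d.
Proof.
move=> dD; apply/eqP; rewrite eq_sym (root_connect (fconnect_sym sgf_inj)).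
exact: (first_return_fconnect sgf_inj).
Qed.

Lemma vert_prev d : d \in Dd -> vert (P d) = vert d.
Proof. by move=> dD; rewrite -{2}(prevK dD) vert_next ?prev_in. Qed.

Lemma ddeg_vert d e : vert d = vert e -> ddeg sg Dd d = ddeg sg Dd e.
Proof.
move/eqP; rewrite (root_connect (fconnect_sym sgf_inj)) => de.
apply: eq_card => x; rewrite !inE; congr (_ && _).
exact: (same_connect (fconnect_sym sgf_inj)).
Qed.

Lemma iscross_vert d e : vert d = vert e -> iscross sg Dd d = iscross sg Dd e.
Proof. by move=> E; rewrite /iscross (ddeg_vert E). Qed.

Lemma ddeg_order d : d \in Dd -> ddeg sg Dd d = fingraph.order N d.
Proof. exact: (card_first_return sgf_inj). Qed.

Lemma next_inj : {in Dd &, injective N}.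
Proof. by move=> x y xD yD e; rewrite -(nextK xD) e nextK. Qed.

Lemma iter_next_ddeg d : d \in Dd -> iter (ddeg sg Dd d) N d = d.
Proof.
by move=> dD; rewrite ddeg_order // (iter_order_in next_in next_inj).
Qed.

Lemma ddeg_neq_cross d : d \in Dd -> ~~ iscross sg Dd d -> ddeg sg Dd d = 2.
Proof.
move=> dD; have := fingraph.order_gt0 N d; rewrite -ddeg_order // /iscross.
by have [_ /(_ d) + _] := diagP; rewrite !inE => /or3P[]/eqP->.
Qed.

(** At crossings and at two-valent points alike, a source-sink structure makes outgoing and incoming
    darts alternate around the vertex. *)
Lemma out_next d : d \in Dd -> (N d \in Out) = (d \notin Out).
Proof.
move=> dD; have [_ _ H2 H4] := outP.
have [c|/(ddeg_neq_cross dD) c] := boolP (iscross sg Dd d).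
  by have [_] := H4 d dD c; do 2!case: (_ \in Out).
by have := H2 d dD c; do 2!case: (_ \in Out).
Qed.

Lemma out_prev d : d \in Dd -> (P d \in Out) = (d \notin Out).
Proof. by move=> dD; rewrite -{2}(prevK dD) out_next ?prev_in // negbK. Qed.

Lemma over_next d : d \in Dd -> iscross sg Dd d -> (N d \in Over) = (d \notin Over).
Proof.
by have [_ _ H] := diagP => dD dc; have [_] := H d dD dc; do 2!case: (_ \in Over).
Qed.

Lemma over_prev d : d \in Dd -> iscross sg Dd d -> (P d \in Over) = (d \notin Over).
Proof.
move=> dD dc; rewrite -{2}(prevK dD) over_next ?prev_in ?negbK //.
by rewrite (iscross_vert (vert_prev dD)).
Qed.

Lemma next2_neq d : d \in Dd -> iscross sg Dd d -> N (N d) != d.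
Proof.
move=> dD /eqP c; have := orbit_uniq N d; rewrite /orb -ddeg_order // c /=.
by rewrite !inE !negb_or => /andP[/and3P[_ + _] _]; rewrite eq_sym.
Qed.

Lemma prev_neq_next d : d \in Dd -> iscross sg Dd d -> P d != N d.
Proof.
move=> dD dc; apply: contraNneq (next2_neq dD dc) => e.
by rewrite -e prevK.
Qed.

Lemma vert_pair s d : d \in Dd -> vert (pairD s d) = vert d.
Proof.
by move=> dD; rewrite /Defs.pairD; do 2?case: ifP => _; rewrite ?vert_next ?vert_prev.
Qed.

Lemma pair_in s d : d \in Dd -> pairD s d \in Dd.
Proof.
by move=> dD; rewrite /Defs.pairD; do 2?case: ifP => _; rewrite ?next_in ?prev_in.
Qed.

Lemma out_pair s d : d \in Dd -> (pairD s d \in Out) = (d \notin Out).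
Proof.
by move=> dD; rewrite /Defs.pairD; do 2?case: ifP => _; rewrite ?out_next ?out_prev.
Qed.

Lemma sv_vert (s : state) d e : vert d = vert e -> sv s d = sv s e.
Proof. by rewrite /sv => ->. Qed.

(** At a crossing, stepping to the neighbour toggles [Over] and with it the choice between [nextD]
    and [prevD], so the second step undoes the first; at a two-valent point [nextD] has order
    two. *)
Lemma pairK s d : d \in Dd -> pairD s (pairD s d) = d.
Proof.
move=> dD; have vd := vert_pair s dD.
rewrite {1}/Defs.pairD (iscross_vert vd) (sv_vert s vd) /Defs.pairD.
case: ifP => [dc|/negbT dc].
  case o: (addb (d \in Over) (sv s d)); rewrite dc ?over_next ?over_prev // addNb o /=.
    by rewrite prevK.
  by rewrite nextK.
by rewrite (negPf dc); have := iter_next_ddeg dD; rewrite ddeg_neq_cross.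
Qed.

Lemma pair_inj s : {in Dd &, injective (pairD s)}.
Proof. by move=> x y xD yD e; rewrite -(pairK s xD) e pairK. Qed.

Lemma phi_in s : {homo phi s : d / d \in Dd}.
Proof. by move=> d dD; rewrite /Defs.phi pair_in ?al_in. Qed.

Lemma phi_inj s : {in Dd &, injective (phi s)}.
Proof.
move=> x y xD yD /pair_inj; rewrite !al_in => /(_ xD yD); exact: perm_inj.
Qed.

(** Both [al] and [pairD] exchange outgoing and incoming darts, so [phi] started at an outgoing dart
    follows the source-sink orientation. *)
Lemma phi_out s : {homo phi s : d / d \in Out}.
Proof.
move=> d dO; have dD := out_in dO.
by rewrite /Defs.phi out_pair ?al_in // out_al // negbK.
Qed.

Lemma phi_inj_out s : {in Out &, injective (phi s)}.
Proof. by move=> x y /out_in xD /out_in yD; apply: phi_inj. Qed.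

(** * Circles as orbits of outgoing darts *)

Lemma crel_sym s : connect_sym (crel s).
Proof.
apply: sym_connect_sym => x y; rewrite /Defs.crel.
case: (boolP (x \in Dd)) => xD; case: (boolP (y \in Dd)) => yD //=.
congr (_ || _); first by apply/eqP/eqP=> ->; rewrite alK.
by apply/eqP/eqP=> ->; rewrite pairK.
Qed.

Lemma connect_al s d : d \in Dd -> connect (crel s) d (al d).
Proof. by move=> dD; apply: connect1; rewrite /Defs.crel dD al_in dD eqxx. Qed.

Lemma connect_pair s d : d \in Dd -> connect (crel s) d (pairD s d).
Proof.
by move=> dD; apply: connect1; rewrite /Defs.crel dD pair_in // eqxx orbT.
Qed.

Lemma connect_phi s d : d \in Dd -> connect (crel s) d (phi s d).
Proof.
move=> dD; apply: connect_trans (connect_al s dD) _.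
by apply: connect_pair; rewrite al_in.
Qed.

Lemma connect_in s x y : connect (crel s) x y -> (x \in Dd) = (y \in Dd).
Proof.
move=> xy; apply: (closed_connect _ xy); apply: (intro_closed (crel_sym s)).
by move=> u v /and3P[].
Qed.

Definition outrep d := if d \in Out then d else al d.

Lemma outrep_out d : d \in Dd -> outrep d \in Out.
Proof. by move=> dD; rewrite /outrep; case: ifP => // /negbT; rewrite out_al. Qed.

Lemma connect_outrep s d : d \in Dd -> connect (crel s) d (outrep d).
Proof.
by move=> dD; rewrite /outrep; case: ifP => _; [apply: connect0 | apply: connect_al].
Qed.

Lemma connect_crelE s x y : x \in Out -> y \in Out ->
  connect (crel s) x y = (y \in orb (phi s) x).
Proof.
move=> xO yO; apply/idP/idP; last first.
  case/trajectP => n _ ->; have xD := out_in xO.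
  have itD m : iter m (phi s) x \in Dd by elim: m => //= m; apply: phi_in.
  elim: n => [|n IH]; first exact: connect0.
  exact: connect_trans IH (connect_phi s (itD n)).
move=> xy; rewrite -fconnect_orbit.
(* The darts whose edge is represented in the orbit of [x] form a set closed under [crel], which
   therefore contains the whole component. *)
pose A := [pred z | fconnect (phi s) x (outrep z)].
have clA : closed (crel s) A.
  apply: (intro_closed (crel_sym s)) => u v /and3P[uD vD uv].
  rewrite !inE => xu; apply: connect_trans xu _.
  have uO := outrep_out uD; have vO := outrep_out vD.
  case/orP: uv => /eqP E; rewrite /outrep E.
    rewrite out_al //; case: (u \in Out) => /=; rewrite ?alK; exact: connect0.
  rewrite out_pair //; case: (boolP (u \in Out)) => uo /=.
    rewrite (fconnect_sym_in (phi_out s) (@phi_inj_out s)) //; last first.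
      by rewrite out_al ?pair_in // out_pair // uo.
    have e : phi s (al (pairD s u)) = u by rewrite /Defs.phi alK pairK.
    by rewrite -[X in connect _ _ X]e fconnect1.
  have -> : pairD s u = phi s (al u) by rewrite /Defs.phi alK.
  exact: fconnect1.
have xA : x \in A by rewrite inE /outrep xO connect0.
by move: xA; rewrite (closed_connect clA xy) inE /outrep yO.
Qed.

(** * Triviality of a circle *)

Lemma trivbP s d : reflect (contractible sg al (circle_walk al Over s d)) (trivb s d).
Proof. by rewrite /Defs.trivb; case: excluded_middle_informative => H; constructor. Qed.

Lemma trivb_phi s d : d \in Dd -> trivb s (phi s d) = trivb s d.
Proof.
move=> dD; have C := cycle_orbitS (phi_in s) (@phi_inj s) dD.
have pd : phi s d \in orb (phi s) d by rewrite -fconnect_orbit fconnect1.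
have E : circle_walk al Over s (phi s d) =
    rot (index (phi s d) (orb (phi s) d)) (orb (phi s) d).
  by rewrite /circle_walk (fingraph.orbitE C) ?orbit_uniq.
by apply/trivbP/trivbP; rewrite E => H; move: H; apply contractible_rot.
Qed.

(** The circle read from [al d] is the inverse walk, up to its starting dart. *)
Lemma trivb_al s d : d \in Dd -> trivb s (al d) = trivb s d.
Proof.
have H e : e \in Dd -> trivb s e -> trivb s (al e).
  move=> eD /trivbP; rewrite /circle_walk => ce; apply/trivbP; rewrite /circle_walk.
  have C := cycle_orbitS (phi_in s) (@phi_inj s) eD.
  have sub := orbit_sub (phi_in s) eD.
  have C' : fcycle (phi s) (winv al (orb (phi s) e)).
    rewrite /winv rev_cycle cycle_map.
    apply: (sub_in_cycle (P := mem Dd)) C; last exact/allP.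
    by move=> x y xD _ /eqP <- /=; rewrite /Defs.phi alK pairK ?al_in.
  rewrite (fingraph.orbitE C').
  - by apply/contractible_rot/contractible_winv.
  - by rewrite rev_uniq map_inj_uniq ?orbit_uniq //; apply: perm_inj.
  - by rewrite mem_rev map_f // in_orbit.
move=> dD; apply/idP/idP; last exact: H.
by rewrite -{2}(alK d); apply: H; rewrite al_in.
Qed.

Lemma trivb_connect s x y : connect (crel s) x y -> trivb s x = trivb s y.
Proof.
move=> xy; have cl : closed (crel s) [pred z | trivb s z == trivb s x].
  apply: (intro_closed (crel_sym s)) => u v /and3P[uD vD].
  rewrite !inE => /orP[] /eqP -> /eqP <-; apply/eqP; first exact: trivb_al.
  have -> : pairD s u = phi s (al u) by rewrite /Defs.phi alK.
  by rewrite trivb_phi ?al_in // trivb_al.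
by have := closed_connect cl xy; rewrite !inE eqxx => /esym/eqP.
Qed.

(** [E'] is [E] with two distinct classes united, those of [a] and [b]. A split is the same relation
    with the two states exchanged. *)
Definition merge_rel (E E' : rel T) a b :=
  ~~ E a b /\
  forall x y, E' x y = E x y || (E a x || E b x) && (E a y || E b y).

Definition two_of_three (t1 t2 t : bool) :=
  [&& t1 && t2 ==> t, t1 && t ==> t2 & t2 && t ==> t1].

Lemma connect_notin s x y : x \notin Dd -> connect (crel s) x y = (x == y).
Proof.
move=> xD; apply/idP/eqP => [/connectP[[|z p] //= /andP[]]|->]; last exact: connect0.
by rewrite /Defs.crel (negPf xD).
Qed.

Section CircleSurgery.
(** The hypotheses do not fix which state precedes the other in the cube; for a split they are
    instantiated in reverse. *)
Variables (s s' : state) (a b : T).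
Hypotheses (aO : a \in Out) (bO : b \in Out).
Hypothesis phiE : {in Out, forall x,
  phi s' x = if phi s x == a then b else if phi s x == b then a else phi s x}.
Hypothesis sep : ~~ connect (crel s) a b.

Lemma orbit_merged : orb (phi s') a = orb (phi s) a ++ orb (phi s) b.
Proof.
apply: (surgery_merge_orbit (phi_out s) (@phi_inj_out s) aO bO phiE).
by rewrite -connect_crelE.
Qed.

Lemma connect_merged x :
  connect (crel s') a x = connect (crel s) a x || connect (crel s) b x.
Proof.
have aD := out_in aO; have bD := out_in bO.
have [xD|xD] := boolP (x \in Dd); last first.
  have F t y : y \in Dd -> connect (crel t) y x = false.
    by move=> yD; apply: contraNF xD => /connect_in <-.
  by rewrite !F.
have E t y : connect (crel t) y x = connect (crel t) y (outrep x).
  exact: (same_connect_r (crel_sym t) (connect_outrep t xD)).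
have rO := outrep_out xD.
by rewrite !E !connect_crelE // orbit_merged mem_cat.
Qed.

(** A circle of [s'] avoiding [a] is an orbit untouched by the surgery; the one through [a] is the
    union of two circles of [s]. *)
Lemma merge_rel_connect : merge_rel (connect (crel s)) (connect (crel s')) a b.
Proof.
split=> // x y; rewrite -!connect_merged.
have [ax|ax] := boolP (connect (crel s') a x).
  rewrite -(same_connect (crel_sym s') ax) /= orb_idl // => xy.
  move: ax; rewrite !connect_merged.
  by case/orP=> /connect_trans/(_ xy) ->; rewrite ?orbT.
rewrite orbF.
have [xD|xD] := boolP (x \in Dd); last by rewrite !connect_notin.
have [yD|yD] := boolP (y \in Dd); last first.
  by rewrite (crel_sym s) (crel_sym s') !connect_notin.
have E t : connect (crel t) x y = connect (crel t) (outrep x) (outrep y).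
  rewrite -(same_connect (crel_sym t) (connect_outrep t xD)).
  exact: (same_connect_r (crel_sym t) (connect_outrep t yD)).
have rxO := outrep_out xD; have ryO := outrep_out yD.
have : ~~ connect (crel s') a (outrep x).
  by rewrite -(same_connect_r (crel_sym s') (connect_outrep s' xD)).
rewrite connect_merged negb_or (crel_sym s) (crel_sym s b) => /andP[nax nbx].
rewrite !E !connect_crelE //.
rewrite (surgery_other (phi_out s) (@phi_inj_out s) phiE) //.
  by rewrite -connect_crelE.
by rewrite -connect_crelE.
Qed.

(** The walk of the joined circle is the concatenation of the two walks, and in a product of loops
    two contractible members force the third. *)
Lemma trivb_merged : two_of_three (trivb s a) (trivb s b) (trivb s' a).
Proof.
apply/and3P; split; apply/implyP=> /andP[/trivbP A /trivbP B]; apply/trivbP;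
  move: A B; rewrite /circle_walk orbit_merged => A B.
- by apply/(contractible_catl _ A).
- by apply/(contractible_catl _ A).
- by apply/(contractible_catr _ A).
Qed.

Lemma trivb_away x : x \in Dd -> ~~ connect (crel s') a x -> trivb s' x = trivb s x.
Proof.
move=> xD nax.
rewrite (trivb_connect (connect_outrep s xD)) (trivb_connect (connect_outrep s' xD)).
have rxO := outrep_out xD.
have : ~~ connect (crel s') a (outrep x).
  by rewrite -(same_connect_r (crel_sym s') (connect_outrep s' xD)).
rewrite connect_merged negb_or (crel_sym s) (crel_sym s b) !connect_crelE //.
case/andP=> na nb; rewrite /Defs.trivb /circle_walk.
by rewrite (surgery_other (phi_out s) (@phi_inj_out s) phiE).
Qed.

End CircleSurgery.

(** * Outgoing darts at a crossing and edges of the cube *)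

Lemma atc_cdart (c : crossing) : atc c (cdart c).
Proof.
have /andP[/eqP rc cc] := valP c.
(* The goal becomes [false]: the vertex carries four darts of the diagram, while [pick] is supposed
   to find none. *)
rewrite /cdart; case: pickP => [//|F] /=; case/negP: (isT : ~~ false).
have [e] : exists e, e \in [pred e | fconnect (sgf sg) (val c) e && (e \in Dd)].
  by apply/card_gt0P; rewrite -/(ddeg sg Dd _) (eqP cc).
rewrite inE => /andP[ce eD]; rewrite -(F e) /atc eD andbT.
by rewrite -[X in _ == X]rc eq_sym (root_connect (fconnect_sym sgf_inj)).
Qed.

Lemma atc_in (c : crossing) d : atc c d -> d \in Dd.
Proof. by case/andP. Qed.

Lemma atc_vert (c : crossing) d : d \in Dd -> atc c d = (vert d == val c).
Proof. by rewrite /atc => ->; rewrite andbT. Qed.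

Lemma atc_cross (c : crossing) d : atc c d -> iscross sg Dd d.
Proof.
case/andP=> /eqP vd _; have /andP[/eqP rc cc] := valP c.
by rewrite (@iscross_vert d (val c)) // vd rc.
Qed.

Lemma atc_next (c : crossing) d : atc c d -> atc c (N d).
Proof. by case/andP=> vd dD; rewrite /atc vert_next // vd next_in. Qed.

Lemma atc_pair s (c : crossing) d : d \in Dd -> atc c (pairD s d) = atc c d.
Proof. by move=> dD; rewrite !atc_vert ?pair_in // vert_pair. Qed.

(** The two outgoing darts at the crossing: by alternation [cdart c] or its neighbour is outgoing,
    and the second one is opposite to it. *)
Definition outa (c : crossing) :=
  if cdart c \in Out then cdart c else N (cdart c).
Definition outb (c : crossing) := N (N (outa c)).

Lemma atc_outa c : atc c (outa c).
Proof. by rewrite /outa; case: ifP => _; rewrite ?atc_next ?atc_cdart. Qed.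

Lemma atc_outb c : atc c (outb c).
Proof. by rewrite !atc_next ?atc_outa. Qed.

Lemma outa_out c : outa c \in Out.
Proof.
rewrite /outa; case: ifP => // /negbT; rewrite out_next //.
exact: atc_in (atc_cdart c).
Qed.

Lemma outb_out c : outb c \in Out.
Proof.
have aD := out_in (outa_out c).
by rewrite /outb !out_next ?next_in // outa_out.
Qed.

Lemma outa_neq_outb c : outa c != outb c.
Proof.
rewrite eq_sym next2_neq ?(atc_cross (atc_outa c)) //; exact: out_in (outa_out c).
Qed.

Lemma atc_outE c d : d \in Out -> atc c d = (d == outa c) || (d == outb c).
Proof.
move=> dO; apply/idP/idP => [|/orP[]/eqP->]; rewrite ?atc_outa ?atc_outb //.
have aD := out_in (outa_out c); have dD := out_in dO.
rewrite atc_vert // => /eqP vd.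
have : fconnect (sgf sg) (outa c) d.
  rewrite -(root_connect (fconnect_sym sgf_inj)) vd.
  by have := atc_outa c; rewrite atc_vert.
rewrite (@first_return_orbit _ _ _ _ _ sgf_inj aD dD) fconnect_orbit.
(* The four darts at the crossing are the iterates of [nextD] from [outa c]; the odd ones are
   incoming. *)
rewrite /orb -(@ddeg_order _ aD) (eqP (atc_cross (atc_outa c))) /=.
have n1 : d != N (outa c).
  by apply: contraTneq dO => ->; rewrite out_next // outa_out.
have n3 : d != N (N (N (outa c))).
  by apply: contraTneq dO => ->; rewrite !out_next ?next_in // outa_out.
by rewrite !inE -/(N _) (negPf n1) (negPf n3) orbF.
Qed.

Local Notation gen := (@gen T sg al Dd Over).
Local Notation st g := (val g).1.
Local Notation lab g := (val g).2.
Local Notation conn s := (connect (crel s)).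

Definition flip (s : state) (c : crossing) : state :=
  [ffun c' => if c' == c then true else s c'].

Lemma sv_flip (s : state) (c : crossing) d :
  sv (flip s c) d = (vert d == val c) || sv s d.
Proof.
rewrite /sv; case: (vert d =P val c) => [->|nc]; first by rewrite valK ffunE eqxx.
case: insubP => //= c' _ e; rewrite ffunE; case: eqP => // E.
by case: nc; rewrite -e E.
Qed.

(** An incoming dart at the crossing has the two outgoing darts as neighbours, and the two
    smoothings join it to different ones. Elsewhere the pairing is unchanged and never lands on
    these two darts. *)
Lemma phi_flip (s : state) (c : crossing) : s c = false -> {in Out, forall x,
  phi (flip s c) x = if phi s x == outa c then outb c else
    if phi s x == outb c then outa c else phi s x}.
Proof.
move=> sc x xO; have xD := out_in xO; rewrite /Defs.phi; set i := al x.
have iD : i \in Dd by rewrite al_in.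
have iO : i \notin Out by rewrite out_al // negbK.
have ab := outa_neq_outb c.
have pO t : pairD t i \in Out by rewrite out_pair.
have [ic|ic] := boolP (atc c i); last first.
  have -> : pairD (flip s c) i = pairD s i.
    by rewrite /Defs.pairD sv_flip -(atc_vert c iD) (negPf ic).
  move: (atc_pair s c iD); rewrite (negPf ic) atc_outE //.
  by move/negbT; rewrite negb_or => /andP[/negPf-> /negPf->].
have ne : pairD (flip s c) i != pairD s i.
  have icr := atc_cross ic.
  have vi : vert i == val c by rewrite -atc_vert.
  rewrite /Defs.pairD icr sv_flip vi /= /sv (eqP vi) valK sc.
  have := prev_neq_next iD icr.
  by case: (i \in Over) => //=; rewrite eq_sym.
have H t : (pairD t i == outa c) || (pairD t i == outb c).
  by rewrite -atc_outE // atc_pair.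
move: ne; case/orP: (H s) => /eqP->; case/orP: (H (flip s c)) => /eqP->;
  by rewrite ?eqxx // [outb c == _]eq_sym (negPf ab).
Qed.

Lemma flip_merge (s : state) (c : crossing) :
  s c = false -> ~~ conn s (outa c) (outb c) ->
  merge_rel (conn s) (conn (flip s c)) (outa c) (outb c).
Proof.
by move=> sc; apply: merge_rel_connect (outa_out c) (outb_out c) (phi_flip sc).
Qed.

Lemma phi_unflip (s : state) (c : crossing) : s c = false -> {in Out, forall x,
  phi s x = if phi (flip s c) x == outa c then outb c else
    if phi (flip s c) x == outb c then outa c else phi (flip s c) x}.
Proof. by move=> sc; apply: surgery_sym; apply: phi_flip. Qed.

Lemma flip_sep (s : state) (c : crossing) : s c = false -> conn s (outa c) (outb c) ->
  ~~ conn (flip s c) (outa c) (outb c).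
Proof.
move=> sc; have aO := outa_out c; have bO := outb_out c.
rewrite !connect_crelE // => h.
apply: (surgery_split_notin (phi_out s) (@phi_inj_out s) aO (phi_flip sc)) => //.
exact: outa_neq_outb.
Qed.

(** Together with [flip_merge] this covers every cube edge, so one circle never turns into one
    circle. *)
Lemma flip_split (s : state) (c : crossing) : s c = false -> conn s (outa c) (outb c) ->
  merge_rel (conn (flip s c)) (conn s) (outa c) (outb c).
Proof.
move=> sc h.
exact: merge_rel_connect (outa_out c) (outb_out c) (phi_unflip sc) (flip_sep sc h).
Qed.

Lemma atc_connect (s : state) (c : crossing) e :
  atc c e -> conn s (outa c) e || conn s (outb c) e.
Proof.
move=> ec; have eD := atc_in ec.
have [eO|eO] := boolP (e \in Out).
  by move: ec; rewrite atc_outE // => /orP[]/eqP->; rewrite connect0 ?orbT.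
have pO : pairD s e \in Out by rewrite out_pair.
have := ec; rewrite -(atc_pair s) // atc_outE //.
have := connect_pair s eD; rewrite crel_sym => h.
by case/orP=> /eqP <-; rewrite h ?orbT.
Qed.

Lemma other_none (s : state) (c : crossing) :
  conn s (outa c) (outb c) -> other al Over s c = None.
Proof.
move=> h; have A e : atc c e -> conn s (outa c) e.
  by move/(atc_connect s) => /orP[//|]; apply: connect_trans.
rewrite /other; case: pickP => // e /andP[ec] /negP[].
rewrite crel_sym; apply: connect_trans (A _ (atc_cdart c)).
by rewrite crel_sym A.
Qed.

(** [cdart c] may lie on the circle of either outgoing dart, whence the two arrangements. *)
Lemma other_some (s : state) (c : crossing) : ~~ conn s (outa c) (outb c) ->
  exists2 e, other al Over s c = Some e &
    conn s (outa c) (cdart c) && conn s (outb c) e ||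
    conn s (outb c) (cdart c) && conn s (outa c) e.
Proof.
move=> h; have A := atc_connect s; rewrite /other; case: pickP => [e /andP[ec ne]|F].
  exists e => //; move: (A _ _ (atc_cdart c)) (A _ _ ec) ne.
  case/orP=> h1; case/orP=> h2; rewrite ?h1 ?h2 ?orbT // => /negP[];
    by apply: connect_trans h2; rewrite crel_sym.
have B e : atc c e -> conn s (cdart c) e.
  by move=> ec; move: (F e); rewrite /= ec => /negbFE.
case/negP: h; apply: connect_trans (B _ (atc_outb c)).
by rewrite crel_sym; apply/B/atc_outa.
Qed.

(** * Matrix coefficients in terms of the outgoing darts *)

Lemma lab_connect (g : gen) d e : conn (st g) d e -> lab g d = lab g e.
Proof.
move=> de; have /andP[/forallP H _] := valP g.
have cl : closed (crel (st g)) [pred z | lab g z == lab g d].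
  apply: (intro_closed (crel_sym _)) => u v uv; rewrite !inE => /eqP <-.
  by move/forallP: (H u) => /(_ v) /implyP/(_ uv); rewrite eq_sym.
by have := closed_connect cl de; rewrite !inE eqxx => /esym/eqP.
Qed.

Lemma lab_notin (g : gen) d : d \notin Dd -> lab g d = false.
Proof.
by have /andP[_ /forallP H] := valP g => dD; have /implyP/(_ dD)/negPf := H d.
Qed.

Definition away (c : crossing) (g g' : gen) :=
  [forall d, ~~ (conn (st g) (outa c) d || conn (st g) (outb c) d) ==>
     (lab g d == lab g' d)].

Lemma awayE (c : crossing) (g g' : gen) :
  [forall d, ~~ [exists e, atc c e && conn (st g) e d] ==> (lab g d == lab g' d)]
  = away c g g'.
Proof.
apply: eq_forallb => d; congr (~~ _ ==> _); apply/existsP/orP.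
  case=> e /andP[/(atc_connect (st g)) /orP[] h /(connect_trans h)]; by [left|right].
by case=> h; [exists (outa c) | exists (outb c)]; rewrite h ?atc_outa ?atc_outb.
Qed.

(** The local maps are symmetric in the two circles, so it does not matter which of them [cdart c]
    selects as the first. *)
Lemma Dh_cC t t1 t2 a b1 b2 : Dh_c t t1 t2 a b1 b2 = Dh_c t t2 t1 a b2 b1.
Proof. by case: t t1 t2 a b1 b2 => [] [] [] [] [] []. Qed.

Lemma mh_cC t1 t2 t a1 a2 b : mh_c t1 t2 t a1 a2 b = mh_c t2 t1 t a2 a1 b.
Proof. by case: t t1 t2 a1 a2 b => [] [] [] [] [] []. Qed.

(** Replaces the chosen darts [cdart c] and [other] by the outgoing ones, so that a single
    connectivity test tells merge from split. *)
Lemma pcoefE (c : crossing) (g g' : gen) : pcoef c g g' =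
  [&& st g c == false, st g' == flip (st g) c, away c g g' &
   if conn (st g) (outa c) (outb c) then
     Dh_c (trivb (st g) (outa c)) (trivb (st g') (outa c)) (trivb (st g') (outb c))
       (lab g (outa c)) (lab g' (outa c)) (lab g' (outb c))
   else
     mh_c (trivb (st g) (outa c)) (trivb (st g) (outb c)) (trivb (st g') (outa c))
       (lab g (outa c)) (lab g (outb c)) (lab g' (outa c))].
Proof.
rewrite /pcoef awayE /cube_edge -/(flip _ c) -andbA.
case: eqP => //= sc; case: eqP => //= sE; congr (_ && _); have lE := @lab_connect.
case: ifP => [h|/negbT h].
  rewrite other_none //; have := flip_sep sc h; rewrite -sE => h'.
  have [e -> H] := other_some h'.
  have ad : conn (st g) (outa c) (cdart c).
    by have /orP[//|] := atc_connect (st g) (atc_cdart c); apply: connect_trans.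
  rewrite -(trivb_connect ad) -(lE _ _ _ ad).
  case/orP: H => /andP[h1 h2].
    by rewrite -(trivb_connect h1) -(trivb_connect h2) -(lE _ _ _ h1) -(lE _ _ _ h2).
  by rewrite Dh_cC -(trivb_connect h1) -(trivb_connect h2) -(lE _ _ _ h1) -(lE _ _ _ h2).
have [e -> H] := other_some h.
have [_ M] := flip_merge sc h; rewrite -sE in M.
have h' : conn (st g') (outa c) (outb c) by rewrite M !connect0 !orbT.
rewrite other_none //.
have ad : conn (st g') (outa c) (cdart c).
  by have /orP[//|] := atc_connect (st g') (atc_cdart c); apply: connect_trans.
rewrite -(trivb_connect ad) -(lE _ _ _ ad).
case/orP: H => /andP[h1 h2].
  by rewrite -(trivb_connect h1) -(trivb_connect h2) -(lE _ _ _ h1) -(lE _ _ _ h2).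
by rewrite mh_cC -(trivb_connect h1) -(trivb_connect h2) -(lE _ _ _ h1) -(lE _ _ _ h2).
Qed.

(** * The degree filtration *)

Local Open Scope ring_scope.

Definition degh (t x : bool) : int := if t then 0 else if x then 1 else -1.

(** A finite check: as exactly two trivial circles cannot occur, the case table of [mh_c] selects
    precisely the terms of [m_c] preserving the degree on nontrivial circles. *)
Lemma mh_c_degh t1 t2 t x1 x2 x : two_of_three t1 t2 t ->
  mh_c t1 t2 t x1 x2 x = m_c x1 x2 x && (degh t x == degh t1 x1 + degh t2 x2).
Proof. by case: t1 t2 t x1 x2 x => [] [] [] [] [] []. Qed.

Lemma m_c_degh t1 t2 t x1 x2 x : two_of_three t1 t2 t ->
  m_c x1 x2 x -> degh t x <= degh t1 x1 + degh t2 x2.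
Proof. by case: t1 t2 t x1 x2 x => [] [] [] [] [] []. Qed.

Lemma Dh_c_degh t t1 t2 x x1 x2 : two_of_three t1 t2 t ->
  Dh_c t t1 t2 x x1 x2 = D_c x x1 x2 && (degh t1 x1 + degh t2 x2 == degh t x).
Proof. by case: t1 t2 t x1 x2 x => [] [] [] [] [] []. Qed.

Lemma D_c_degh t t1 t2 x x1 x2 : two_of_three t1 t2 t ->
  D_c x x1 x2 -> degh t1 x1 + degh t2 x2 <= degh t x.
Proof. by case: t1 t2 t x1 x2 x => [] [] [] [] [] []. Qed.

Definition dart_deg (g : gen) d := degh (trivb (st g) d) (lab g d).

Definition circle_size (g : gen) d := #|[pred e | conn (st g) d e]|.

(* Total degree of the nontrivial circles; each circle spreads its degree
   evenly over its darts, whence the rational weights. *)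
Definition tau (g : gen) : rat :=
  \sum_(d in Dd) (dart_deg g d)%:~R / (circle_size g d)%:R.

(** Degree and size are constant along a circle, so the evenly spread weights add up to the degree
    itself. *)
Lemma sum_circle (g : gen) a :
  \sum_(d | conn (st g) a d) (dart_deg g d)%:~R / (circle_size g d)%:R
    = (dart_deg g a)%:~R :> rat.
Proof.
rewrite (eq_bigr (fun=> (dart_deg g a)%:~R / (circle_size g a)%:R)); last first.
  move=> d ad; rewrite /dart_deg -(lab_connect ad) -(trivb_connect ad).
  congr (_ / _%:R); apply: eq_card => e; rewrite !inE.
  exact/esym/(same_connect (crel_sym _) ad).
rewrite sumr_const -[#|_|]/(circle_size g a) -[LHS]mulr_natr divfK //.
by rewrite pnatr_eq0 -lt0n; apply/card_gt0P; exists a; rewrite inE connect0.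
Qed.

(** Once the circles taking part are removed, the same circles with the same degrees remain on both
    sides. *)
Lemma tau_merge (g g' : gen) a b : a \in Dd -> b \in Dd ->
    merge_rel (conn (st g)) (conn (st g')) a b ->
    (forall d, d \in Dd -> ~~ conn (st g') a d -> dart_deg g d = dart_deg g' d) ->
  tau g - (dart_deg g a + dart_deg g b)%:~R = tau g' - (dart_deg g' a)%:~R.
Proof.
move=> aD bD [nab M] same.
have E x : conn (st g') a x = conn (st g) a x || conn (st g) b x.
  by rewrite M connect0 /= orbA orbb.
rewrite /tau !(bigID (conn (st g') a) (mem Dd)) /=.
have -> : \sum_(i in Dd | conn (st g') a i)
    (dart_deg g' i)%:~R / (circle_size g' i)%:R = (dart_deg g' a)%:~R :> rat.
  rewrite -[RHS]sum_circle; apply: eq_bigl => d.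
  by rewrite andb_idl // => /connect_in <-.
have -> : \sum_(i in Dd | conn (st g') a i)
    (dart_deg g i)%:~R / (circle_size g i)%:R
    = (dart_deg g a)%:~R + (dart_deg g b)%:~R :> rat.
  rewrite (bigID (conn (st g) a)) /=.
  rewrite -[X in _ = X + _]sum_circle -[X in _ = _ + X]sum_circle.
  congr (_ + _); apply: eq_bigl => d; rewrite E.
    by case h: (conn (st g) a d); rewrite ?andbF ?andbT //= -(connect_in h).
  case h: (conn (st g) a d) => /=; rewrite ?andbF ?andbT.
    apply/esym; apply: contraNF nab => h'; apply: connect_trans h _.
    by rewrite crel_sym.
  by rewrite andb_idl // => /connect_in <-.
rewrite -intrD ![_%:~R + _]addrC !addrK; apply: eq_bigr => d /andP[dD nd].
rewrite same //; congr (_ / _%:R); apply: eq_card => e; rewrite !inE M -!E.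
by rewrite (negPf nd) orbF.
Qed.

(** Matrix of the full Khovanov edge map at [c], in the form that [pcoefE] gives for the homotopical
    one. *)
Definition kcoef c (g g' : gen) :=
  [&& st g c == false, st g' == flip (st g) c, away c g g' &
   if conn (st g) (outa c) (outb c) then
     D_c (lab g (outa c)) (lab g' (outa c)) (lab g' (outb c))
   else m_c (lab g (outa c)) (lab g (outb c)) (lab g' (outa c))].

(** Circles away from the crossing keep label and triviality, so [tau] changes by the local change
    of degree, to which the finite checks on [degh] apply. *)
Lemma pcoef_kcoef c (g g' : gen) : pcoef c g g' = kcoef c g g' && (tau g' == tau g)
  /\ (kcoef c g g' -> tau g' <= tau g).
Proof.
rewrite pcoefE /kcoef.
case: (st g c =P false) => //= sc; case: (st g' =P _) => //= sE.
case: (boolP (away c g g')) => //= /forallP aw.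
have aD := out_in (outa_out c); have bD := out_in (outb_out c).
have PE := phi_flip sc; have PE' := phi_unflip sc.
rewrite -sE in PE PE'.
case: (boolP (conn _ _ _)) => [h|nh].
  (* A split is handled as a merge from [st g'] to [st g], whence the exchanged arguments of
     [tau_merge]. *)
  have sep := flip_sep sc h; have M := flip_split sc h.
  rewrite -sE in sep M.
  have TT := trivb_merged (outa_out c) (outb_out c) PE' sep.
  have TA := trivb_away (outa_out c) (outb_out c) PE' sep.
  have := @tau_merge g' g _ _ aD bD M.
  have Hs d : d \in Dd -> ~~ conn (st g) (outa c) d -> dart_deg g' d = dart_deg g d.
    move=> dD nd; rewrite /dart_deg TA //; congr degh; apply/esym/eqP.
    apply: (implyP (aw d)).
    by rewrite -(same_connect (crel_sym _) h) orbb.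
  move=> /(_ Hs) TE.
  have -> : tau g' = tau g +
    (dart_deg g' (outa c) + dart_deg g' (outb c) - dart_deg g (outa c))%:~R.
    by rewrite rmorphB /=; lra.
  split; last first.
    move/(D_c_degh TT) => H.
    by rewrite gerDl -[0]/(0%:~R) ler_int subr_le0.
  rewrite (Dh_c_degh _ _ _ TT); congr (_ && _).
  by rewrite -[RHS]subr_eq0 addrAC subrr add0r intr_eq0 subr_eq0.
have M := flip_merge sc nh.
rewrite -sE in M.
have TT := trivb_merged (outa_out c) (outb_out c) PE nh.
have TA := trivb_away (outa_out c) (outb_out c) PE nh.
have := @tau_merge g g' _ _ aD bD M.
have Hs d : d \in Dd -> ~~ conn (st g') (outa c) d -> dart_deg g d = dart_deg g' d.
  move=> dD nd; rewrite /dart_deg TA //; congr degh; apply/eqP.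
  apply: (implyP (aw d)).
  by rewrite -(connect_merged (outa_out c) (outb_out c) PE nh).
move=> /(_ Hs) TE.
have -> : tau g' = tau g +
    (dart_deg g' (outa c) - (dart_deg g (outa c) + dart_deg g (outb c)))%:~R.
  by rewrite rmorphB /=; lra.
split; last first.
  move/(m_c_degh TT) => H.
  by rewrite gerDl -[0]/(0%:~R) ler_int subr_le0.
rewrite (mh_c_degh _ _ _ TT); congr (_ && _).
by rewrite -[RHS]subr_eq0 addrAC subrr add0r intr_eq0 subr_eq0.
Qed.

(** * Commuting squares of the full Khovanov maps *)

Definition occ (s : state) (w : seq T) (d : T) : nat := count (conn s d) w.
Arguments occ : simpl never.

(* The monomial [w] in commuting variables X_d with X_d ^ 2 = 0, read modulo
   X_d = X_e for d, e on the same circle of D_s, where v_+ = 1 and v_- = X: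
   [mono s w g] is its coefficient on [g]. *)
Definition mono (s : state) (w : seq T) (g : gen) : bool :=
  (st g == s) && [forall d, (d \in Dd) ==> (occ s w d == ~~ lab g d :> nat)].

Lemma occ_connect s w d e : conn s d e -> occ s w d = occ s w e.
Proof. by move=> de; apply: eq_count => y; apply: (same_connect (crel_sym s)). Qed.

Lemma occ_merge s s' a b w : merge_rel (conn s) (conn s') a b ->
  occ s' w a = (occ s w a + occ s w b)%N.
Proof.
case=> nab M; rewrite /occ -count_predUI.
rewrite (@eq_count _ (predI _ _) pred0) ?count_pred0 ?addn0; last first.
  move=> y /=; apply/negP => /andP[ay yb]; case/negP: nab.
  by apply: connect_trans ay _; rewrite crel_sym.
by apply: eq_count => y /=; rewrite M connect0 orbA orbb.
Qed.

Lemma occ_away s s' a b w d : merge_rel (conn s) (conn s') a b ->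
  ~~ (conn s a d || conn s b d) -> occ s' w d = occ s w d.
Proof.
by case=> nab M /negPf nd; apply: eq_count => y; rewrite M nd orbF.
Qed.

Lemma merge_relE s s' a b d : merge_rel (conn s) (conn s') a b ->
  conn s' a d = conn s a d || conn s b d.
Proof. by case=> _ ->; rewrite connect0 orbA orbb. Qed.

Lemma mono_gen s w : (forall d, d \in Dd -> occ s w d <= 1)%N ->
  exists g : gen, forall h, mono s w h = (h == g).
Proof.
move=> le1; pose l : label T := [ffun d => (d \in Dd) && (occ s w d == 0)%N].
have v : validg al Over (s, l).
  apply/andP; split; apply/forallP => d; last by rewrite /= ffunE; case: (d \in Dd).
  apply/forallP=> e; apply/implyP=> de; have /and3P[dD eD _] := de.
  by rewrite /= !ffunE dD eD (occ_connect _ (connect1 de)).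
exists (Sub (s, l) v) => h; apply/andP/eqP => [[/eqP hs /forallP H]|->]; last first.
  split=> //; apply/forallP => d; apply/implyP => dD.
  by rewrite /= ffunE dD; have := le1 d dD; case: (occ _ _ _) => [|[]].
apply: val_inj => /=; rewrite [LHS]surjective_pairing hs; congr (_, _).
apply/ffunP => d; rewrite ffunE; case: (boolP (d \in Dd)) => dD.
  by have /implyP/(_ dD)/eqP-> := H d; case: (lab h d).
exact: lab_notin.
Qed.

Lemma gen_mono (g : gen) : exists2 w, {subset w <= Dd} &
  forall h, mono (st g) w h = (h == g).
Proof.
pose s := st g.
(* One dart for each circle labelled v_-, namely its root under [crel]; a second dart on the same
   circle would give a square. *)
pose w := [seq y <- enum T | [&& y \in Dd, ~~ lab g y & fingraph.root (crel s) y == y]].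
have wD : {subset w <= Dd} by move=> y; rewrite mem_filter => /andP[/and3P[]].
exists w => // h.
have O d : d \in Dd -> occ s w d = ~~ lab g d.
  move=> dD; rewrite /occ count_filter.
  case ld: (lab g d) => /=.
    rewrite (@eq_count _ _ pred0) ?count_pred0 // => y /=.
    by apply/negP => /andP[dy] /and3P[_ + _]; rewrite -(lab_connect dy) ld.
  rewrite (@eq_count _ _ (pred1 (fingraph.root (crel s) d))); last first.
    move=> y /=; apply/andP/eqP => [[dy /and3P[_ _ /eqP e]]|->].
      by rewrite -e; apply/eqP; rewrite (fingraph.root_connect (crel_sym s)) crel_sym.
    have dr := connect_root (crel s) d; split=> //.
    rewrite -(connect_in dr) dD -(lab_connect dr) ld /=.
    by apply/eqP/fingraph.root_root; apply: crel_sym.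
  by rewrite count_uniq_mem ?enum_uniq // mem_enum.
have [g0 G0] : exists g0 : gen, forall h, mono s w h = (h == g0).
  by apply: mono_gen => d dD; rewrite O //; case: (lab g d).
suff gg : g = g0 by rewrite -/s G0 -gg.
by apply/eqP; rewrite -G0 /mono eqxx /=; apply/forallP => d; apply/implyP => /O ->.
Qed.

(** Isolates the circles through [a] and [b], the ones affected at a crossing; a label is constant
    along each. *)
Lemma mono_split s w (g : gen) a b : a \in Dd -> b \in Dd ->
  mono s w g = [&& st g == s,
    [forall d, (d \in Dd) && ~~ (conn s a d || conn s b d) ==>
       (occ s w d == ~~ lab g d :> nat)],
    occ s w a == ~~ lab g a :> nat & occ s w b == ~~ lab g b :> nat].
Proof.
move=> aD bD; rewrite /mono; case: eqP => //= gs.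
apply/forallP/and3P => [H|[/forallP H /eqP Ha /eqP Hb] d].
  split; try by apply: (implyP (H _)).
  by apply/forallP => d; apply/implyP => /andP[dD _]; apply: (implyP (H d)).
apply/implyP => dD.
case: (boolP (conn s a d)) => ad.
  by rewrite -(occ_connect _ ad) Ha (@lab_connect g a d) ?gs.
case: (boolP (conn s b d)) => bd.
  by rewrite -(occ_connect _ bd) Hb (@lab_connect g b d) ?gs.
by apply: (implyP (H d)); rewrite dD negb_or ad bd.
Qed.

Lemma m_cE x1 x2 x : m_c x1 x2 x = (~~ x1 + ~~ x2 == ~~ x)%N.
Proof. by case: x1 x2 x => [] [] []. Qed.

(** A split raises the total exponent of X by one: v_+ goes to X_a + X_b and v_- to X_a X_b. *)
Lemma D_cE x x1 x2 : D_c x x1 x2 = (~~ x1 + ~~ x2 == (~~ x).+1)%N.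
Proof. by case: x1 x2 x => [] [] []. Qed.

Definition push c (f : gen -> 'F_2) (g' : gen) : 'F_2 :=
  \sum_(g : gen) (kcoef c g g')%:R * f g.

Definition monoF (s : state) (w : seq T) (g : gen) : 'F_2 := (mono s w g)%:R.

Lemma F2_addrr (x : 'F_2) : x + x = 0.
Proof. by case: x => [[|[|]]] // i; apply/val_inj. Qed.

Lemma away_occ (s : state) (c : crossing) w (g0 g' : gen) : st g0 = s ->
  (forall d, d \in Dd -> occ s w d = ~~ lab g0 d) ->
  away c g0 g' =
  [forall d, (d \in Dd) && ~~ (conn s (outa c) d || conn s (outb c) d) ==>
     (occ s w d == ~~ lab g' d :> nat)].
Proof.
move=> sE O; rewrite /away sE; apply: eq_forallb => d.
case: (boolP (d \in Dd)) => dD /=; last by rewrite !lab_notin // eqxx implybT.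
by rewrite O //; case: (lab g0 d); case: (lab g' d).
Qed.

Lemma push_mono (s : state) (c : crossing) w : s c = false -> {subset w <= Dd} ->
  push c (monoF s w) =1 fun g' =>
    if conn s (outa c) (outb c)
    then monoF (flip s c) (outa c :: w) g' + monoF (flip s c) (outb c :: w) g'
    else monoF (flip s c) w g'.
Proof.
move=> sc wD g'; rewrite /push /monoF; set a := outa c; set b := outb c.
have aD : a \in Dd := out_in (outa_out c); have bD : b \in Dd := out_in (outb_out c).
have occ_cons s1 x v d : occ s1 (x :: v) d = (conn s1 d x + occ s1 v d)%N by [].
(* Either no circle carries a square and [w] is a single generator [g0], or some circle carries one
   and both sides vanish. *)
have [/forallP le1|/forallPn[d]] := boolP [forall d, (d \in Dd) ==> (occ s w d <= 1)%N].
  have [d dD|g0 G0] := @mono_gen s w; first exact: (implyP (le1 d)).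
  have /andP[/eqP s0 /forallP O0] : mono s w g0 by rewrite G0.
  have O d : d \in Dd -> occ s w d = ~~ lab g0 d.
    by move=> dD; apply/eqP; apply: (implyP (O0 d)).
  rewrite (bigD1 g0) //= G0 eqxx mulr1 big1 ?addr0; last first.
    by move=> h /negPf hg; rewrite G0 hg mulr0.
  rewrite /kcoef s0 sc (away_occ _ _ s0 O) /= -/a -/b.
  case: ifP => [ab|/negbT ab].
    have M := flip_split sc ab; have sep := flip_sep sc ab.
    rewrite D_cE -O // (occ_merge _ M) !(mono_split _ _ _ aD bD).
    case: eqP => _ /=; last by rewrite addr0.
    rewrite -/a -/b in sep *.
    have nd d : ~~ conn s a d = ~~ (conn (flip s c) a d || conn (flip s c) b d).
      by rewrite (merge_relE _ M).
    have aw x : (x == a) || (x == b) ->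
       [forall d, (d \in Dd) && ~~ (conn (flip s c) a d || conn (flip s c) b d) ==>
         (occ (flip s c) (x :: w) d == ~~ lab g' d :> nat)] =
       [forall d, (d \in Dd) && ~~ (conn s a d || conn s b d) ==>
         (occ s w d == ~~ lab g' d :> nat)].
      move=> xab; apply: eq_forallb => d.
      rewrite -(same_connect (crel_sym s) ab) orbb nd.
      case: (boolP (_ || _)) => h; rewrite ?andbF //= andbT; congr (_ ==> (_ == _)).
      rewrite occ_cons -(occ_away _ M h).
      move: h; rewrite negb_or !(crel_sym _ _ d).
      by case/orP: xab => /eqP-> /andP[/negPf h1 /negPf h2]; rewrite ?h1 ?h2.
    rewrite !aw ?eqxx ?orbT //; case: [forall d, _] => /=; last by rewrite addr0.
    rewrite !occ_cons !connect0 [conn _ b a]crel_sym (negPf sep) !add0n !add1n.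
    (* Before the split [a] and [b] share a circle, so [le1] bounds the sum of their exponents by
       one and few cases remain. *)
    have := le1 a; rewrite aD /= (occ_merge _ M).
    case: (lab g' a); case: (lab g' b) => /=;
      case: (occ _ w a) => [|[|n]]; case: (occ _ w b) => [|[|m]] //= _;
      by rewrite ?addr0 ?add0r.
  have M := flip_merge sc ab.
  have ab' : conn (flip s c) a b by rewrite (merge_relE _ M) connect0 orbT.
  rewrite m_cE -!O // -(occ_merge _ M) (mono_split _ _ _ aD bD).
  case: eqP => //= sE; congr (_%:R : 'F_2).
  rewrite -(occ_connect _ ab') -(@lab_connect g' a b) ?sE // andbb.
  congr ((_ && _) : nat); apply: eq_forallb => d.
  rewrite -(same_connect (crel_sym (flip s c)) ab') orbb (merge_relE _ M).
  case: (boolP (_ || _)) => h; rewrite ?andbF //= andbT; congr (_ ==> (_ == _)).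
  by rewrite (occ_away _ M h).
rewrite negb_imply -ltnNge => /andP[dD d2].
rewrite big1; last first.
  move=> h _; rewrite [mono s w h](_ : _ = false) ?mulr0 //; apply/negP => /andP[_].
  move/forallP/(_ d)/implyP/(_ dD)/eqP => e; move: d2; rewrite e.
  by case: (lab h d).
have no s1 v x : x \in Dd -> (1 < occ s1 v x)%N -> mono s1 v g' = false.
  move=> xD x2; apply/negP => /andP[_].
  move/forallP/(_ x)/implyP/(_ xD)/eqP => e; move: x2; rewrite e.
  by case: (lab g' x).
case: ifP => [ab|/negbT ab].
  have M := flip_split sc ab.
  have sub x : (1 < occ (flip s c) w d)%N -> mono (flip s c) (x :: w) g' = false.
    by move=> h; apply: no dD _; rewrite occ_cons ltn_addl.
  case: (boolP (conn (flip s c) a d || conn (flip s c) b d)) => h; last first.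
    by move: d2; rewrite (occ_away _ M h) => d2; rewrite !sub // addr0.
  move: d2; rewrite -(occ_connect w (_ : conn s a d)) ?(merge_relE _ M) //.
  rewrite (occ_merge _ M) -/a -/b => d2.
  have na x : (0 < occ (flip s c) w x)%N -> x \in Dd ->
      mono (flip s c) (x :: w) g' = false.
    by move=> h1 xD; apply: no xD _; rewrite occ_cons connect0.
  have nb x y : x \in Dd -> (1 < occ (flip s c) w x)%N ->
      mono (flip s c) (y :: w) g' = false.
    by move=> xD h1; apply: no xD _; rewrite occ_cons ltn_addl.
  (* At least two factors are spread over the two new circles: with one on each, either new factor
     creates a square; otherwise a square is already there. *)
  case ea: (occ (flip s c) w a) d2 => [|[|n]]; rewrite ?add0n ?add1n => d2.
  - by rewrite !(nb b) // addr0.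
  - by rewrite (na a) ?ea // (na b) ?addr0.
  - by rewrite !(nb a) ?ea // addr0.
have M := flip_merge sc ab.
rewrite (no _ _ d) //; case: (boolP (conn s a d || conn s b d)) => h; last first.
  by rewrite (occ_away _ M h).
rewrite -(occ_connect w (_ : conn _ a d)) ?(merge_relE _ M) // (occ_merge _ M).
case/orP: h => /(occ_connect w) ->; first exact: ltn_addr.
exact: ltn_addl.
Qed.

Lemma push_eq c f1 f2 : f1 =1 f2 -> push c f1 =1 push c f2.
Proof. by move=> e g'; apply: eq_bigr => g _; rewrite e. Qed.

Lemma pushD c f1 f2 :
  push c (fun g => f1 g + f2 g) =1 fun g' => push c f1 g' + push c f2 g'.
Proof. by move=> g'; rewrite -big_split; apply: eq_bigr => g _; rewrite mulrDr. Qed.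

Lemma monoF_swap s x y w : monoF s [:: x, y & w] =1 monoF s [:: y, x & w].
Proof.
move=> g; rewrite /monoF /mono; congr ((_ && _)%:R : 'F_2).
by apply: eq_forallb => d; rewrite /occ /= addnCA.
Qed.

Lemma monoF_connect s x y w : conn s x y -> monoF s (x :: w) =1 monoF s (y :: w).
Proof.
move=> xy g; rewrite /monoF /mono; congr ((_ && _)%:R : 'F_2).
apply: eq_forallb => d; congr (_ ==> (_ == _)); rewrite /occ /=.
by rewrite (same_connect_r (crel_sym s) xy).
Qed.

Lemma flip_other (s : state) (c1 c2 : crossing) :
  s c2 = false -> c1 != c2 -> flip s c1 c2 = false.
Proof. by move=> sc2 c12; rewrite ffunE eq_sym (negPf c12). Qed.

Lemma flipC (s : state) (c1 c2 : crossing) :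
  flip (flip s c1) c2 = flip (flip s c2) c1.
Proof. by apply/ffunP => c; rewrite !ffunE; do 2?case: ifP. Qed.

Lemma outs_in c w : {subset w <= Dd} ->
  {subset outa c :: w <= Dd} /\ {subset outb c :: w <= Dd}.
Proof.
move=> wD; split=> x; rewrite inE => /orP[/eqP->|/wD //].
  exact: out_in (outa_out c).
exact: out_in (outb_out c).
Qed.

Lemma push2_mono (s : state) (c1 c2 : crossing) w :
  s c1 = false -> s c2 = false -> c1 != c2 -> {subset w <= Dd} ->
  push c2 (push c1 (monoF s w)) =1 fun g =>
    let M := monoF (flip (flip s c1) c2) in
    match conn s (outa c1) (outb c1), conn (flip s c1) (outa c2) (outb c2) with
    | true, true => M [:: outa c2, outa c1 & w] g + M [:: outb c2, outa c1 & w] g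
        + (M [:: outa c2, outb c1 & w] g + M [:: outb c2, outb c1 & w] g)
    | true, false => M (outa c1 :: w) g + M (outb c1 :: w) g
    | false, true => M (outa c2 :: w) g + M (outb c2 :: w) g
    | false, false => M w g
    end.
Proof.
move=> sc1 sc2 c12 wD g; rewrite (push_eq _ (push_mono sc1 wD)).
have [aw bw] := outs_in c1 wD.
have sc2' := flip_other sc2 c12.
case h: (conn s (outa c1) (outb c1)) => /=.
  rewrite (pushD c2 (monoF _ _) (monoF _ _)) !(push_mono sc2') //.
  by case: (conn (flip s c1) _ _).
by rewrite (push_mono sc2').
Qed.

(** Otherwise [c1] would join its two darts after [c2], whereas in the other order [c1] separates
    them and the split at [c2] only refines the circles. *)
Lemma square_conn (s : state) (c1 c2 : crossing) :
  s c1 = false -> s c2 = false -> c1 != c2 ->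
  conn s (outa c1) (outb c1) -> conn s (outa c2) (outb c2) ->
  conn (flip s c1) (outa c2) (outb c2) -> conn (flip s c2) (outa c1) (outb c1).
Proof.
move=> sc1 sc2 c12 h1 h2 h1'; apply: contraT => h2'.
have c21 : c2 != c1 by rewrite eq_sym.
have := flip_merge (flip_other sc1 c21) h2'; rewrite -flipC.
move/merge_relE => M; have [_ S1] := flip_split (flip_other sc2 c12) h1'.
case/negP: (flip_sep sc1 h1); rewrite S1 M connect0 orbT //.
Qed.

Lemma push_comm (s : state) (c1 c2 : crossing) w :
  s c1 = false -> s c2 = false -> c1 != c2 -> {subset w <= Dd} ->
  push c2 (push c1 (monoF s w)) =1 push c1 (push c2 (monoF s w)).
Proof.
move=> sc1 sc2 c12 wD g; have c21 : c2 != c1 by rewrite eq_sym.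
have f2 := flip_other sc2 c12; have f1 := flip_other sc1 c21.
rewrite (push2_mono sc1 sc2 c12 wD) (push2_mono sc2 sc1 c21 wD) -(flipC s c1 c2).
cbv zeta; set s3 := flip (flip s c1) c2.
have E3 : s3 = flip (flip s c2) c1 by rewrite /s3 flipC.
have self x y v : conn s3 x y -> monoF s3 (x :: v) g + monoF s3 (y :: v) g = 0.
  by move=> xy; rewrite (monoF_connect _ xy) F2_addrr.
case: (boolP (conn s (outa c1) (outb c1))) => h1;
  case: (boolP (conn s (outa c2) (outb c2))) => h2.
(* Both crossings split at first. If both second steps split too, the products agree up to the order
   of their factors; otherwise both second steps merge, and X_a + X_b vanishes as its two variables
   become equal. *)
- case: (boolP (conn (flip s c1) _ _)) => h1'.
    rewrite (square_conn sc1 sc2 c12) //.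
    rewrite !(monoF_swap _ _ (outa c1)) !(monoF_swap _ _ (outb c1)).
    by rewrite addrACA.
  have /negPf h2' : ~~ conn (flip s c2) (outa c1) (outb c1).
    by apply: contra h1'; apply: square_conn.
  rewrite h2' !self // /s3.
    by rewrite (merge_relE _ (flip_merge f2 h1')) connect0 orbT.
  rewrite flipC.
  by rewrite (merge_relE _ (flip_merge f1 (negbT h2'))) connect0 orbT.
(* A split only refines the circles and a merge only coarsens them, so either order consists of a
   split at [c1] and a merge at [c2]. *)
- have -> : conn (flip s c1) (outa c2) (outb c2) = false.
    apply: contraNF h2; have [_ ->] := flip_split sc1 h1.
    by move=> ->.
  have [_ ->] := flip_merge sc2 h2.
  by rewrite h1.
- have -> : conn (flip s c2) (outa c1) (outb c1) = false.
    apply: contraNF h1; have [_ ->] := flip_split sc2 h2.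
    by move=> ->.
  have [_ ->] := flip_merge sc1 h1.
  by rewrite h2.
have [_ M1] := flip_merge sc1 h1; have [_ M2] := flip_merge sc2 h2.
have tr x y z : conn s x y -> conn s x z -> conn s y z.
  by rewrite crel_sym; apply: connect_trans.
(* After one merge the other crossing meets a single circle exactly when both crossings lie between
   the same two circles, a symmetric condition. *)
have E : conn (flip s c1) (outa c2) (outb c2) = conn (flip s c2) (outa c1) (outb c1).
  rewrite M1 M2 (negPf h1) (negPf h2) /=.
  rewrite ![conn s (outa c2) _]crel_sym ![conn s (outb c2) _]crel_sym.
  have n1 x : ~~ (conn s x (outa c2) && conn s x (outb c2)).
    by apply: contra h2 => /andP[]; apply: tr.
  have n2 x : ~~ (conn s (outa c1) x && conn s (outb c1) x).
    by apply: contra h1 => /andP[]; rewrite ![conn s _ x]crel_sym; apply: tr.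
  move: (n1 (outa c1)) (n1 (outb c1)) (n2 (outa c2)) (n2 (outb c2)).
  by do 4!case: (conn s _ _).
case: (boolP (conn (flip s c1) _ _)) => h1'; last by rewrite -E (negPf h1').
have h2' := h1'; rewrite E in h2'; rewrite h2'.
have S1 := flip_split f2 h1'; have S2 := flip_split f1 h2'.
have [nab1 _] := S2; have [nab2 _] := S1; rewrite -flipC -/s3 in nab1 nab2.
(* In the final state the outgoing darts at [c1] lie on distinct circles, each being that of
   [outa c2] or [outb c2], so the sums X_a + X_b at the two crossings have the same terms. *)
have mem x : conn (flip s c1) (outa c1) x -> conn s3 (outa c2) x || conn s3 (outb c2) x.
  rewrite -(merge_relE _ S1) => a1x; apply: connect_trans a1x.
  have := h1'; rewrite M1 (negPf h2) /= => /andP[+ _].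
  by rewrite -(merge_relE _ (flip_merge sc1 h1)) crel_sym.
have a1m := mem (outa c1) (connect0 _ _).
have := mem (outb c1); rewrite (merge_relE _ (flip_merge sc1 h1)) connect0 orbT.
have U x : conn s3 x (outa c1) -> conn s3 x (outb c1) -> false.
  by move=> xa xb; case/negP: nab1; rewrite crel_sym in xa; apply: connect_trans xa xb.
move=> /(_ isT); case/orP: a1m => ha; case/orP => hb.
- by have := U _ ha hb.
- by rewrite (monoF_connect _ ha) (monoF_connect _ hb).
- by rewrite (monoF_connect _ ha) (monoF_connect _ hb) addrC.
- by have := U _ ha hb.
Qed.

(** * Cancellation of the two-step paths in the cube *)

Lemma sum_sym_F2 (I : finType) (F : I -> I -> 'F_2) :
  (forall i j, F i j = F j i) -> (forall i, F i i = 0) ->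
  \sum_i \sum_j F i j = 0.
Proof.
move=> symF F0; pose r (i j : I) := (enum_rank i < enum_rank j)%N.
(* The order by [enum_rank] matches each term above the diagonal with its mirror image; equal terms
   cancel in characteristic two. *)
have -> : \sum_i \sum_j F i j =
    \sum_i \sum_j (if r i j then F i j else 0)
    + \sum_i \sum_j (if ~~ r j i then F j i else 0).
  rewrite [X in _ + X]exchange_big -big_split; apply: eq_bigr => i _.
  rewrite -big_split; apply: eq_bigr => j _ /=.
  by case: (r i j); rewrite ?addr0 ?add0r.
rewrite -big_split big1 // => i _; rewrite -big_split big1 // => j _ /=.
rewrite /r -leqNgt (symF j i); case: ltngtP => [_|_|e].
- exact: F2_addrr.
- exact: addr0.
- by rewrite (enum_rank_inj (ord_inj e)) F0 addr0.
Qed.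

Definition kcomp c1 c2 (g g2 : gen) : 'F_2 :=
  \sum_(g1 : gen) (kcoef c1 g g1)%:R * (kcoef c2 g1 g2)%:R.

Lemma kcompE c1 c2 (g g2 : gen) w :
  (forall h, mono (st g) w h = (h == g)) ->
  kcomp c1 c2 g g2 = push c2 (push c1 (monoF (st g) w)) g2.
Proof.
move=> wE; rewrite /kcomp; apply: eq_bigr => g1 _; rewrite mulrC; congr (_ * _).
rewrite /push (bigD1 g) //= /monoF wE eqxx mulr1 big1 ?addr0 // => h /negPf hg.
by rewrite wE hg mulr0.
Qed.

Lemma kcomp_diag c (g g2 : gen) : kcomp c c g g2 = 0.
Proof.
rewrite /kcomp big1 // => g1 _; case h: (kcoef c g g1); last by rewrite mul0r.
have /and4P[_ /eqP e _ _] := h.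
by rewrite /kcoef e ffunE eqxx /= mulr0.
Qed.

Lemma kcomp_resolved c1 c2 (g g2 : gen) : st g c1 ->
  kcomp c1 c2 g g2 = 0 /\ kcomp c2 c1 g g2 = 0.
Proof.
move=> s1; rewrite /kcomp; split; apply: big1 => g1 _.
  by rewrite {1}/kcoef s1 mul0r.
case h: (kcoef c2 g g1); last by rewrite mul0r.
have /and4P[_ /eqP e _ _] := h.
by rewrite /kcoef e ffunE s1 if_same /= mulr0.
Qed.

(** If the crossings coincide or one is already in state 1, this is immediate; otherwise the source
    generator is a monomial and [push_comm] applies. *)
Lemma kcompC c1 c2 (g g2 : gen) : kcomp c1 c2 g g2 = kcomp c2 c1 g g2.
Proof.
have [->//|c12] := eqVneq c1 c2.
case s1: (st g c1); first by have [-> ->] := kcomp_resolved c2 g2 s1.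
case s2: (st g c2); first by have [-> ->] := kcomp_resolved c1 g2 s2.
have [w wD wE] := gen_mono g.
by rewrite !(kcompE _ _ _ wE); apply: push_comm.
Qed.

Lemma dh_dh (f : chain sg al Dd Over) (g : gen) : dh (dh f) g = 0.
Proof.
pose p c (g1 g2 : gen) : 'F_2 := (pcoef c g1 g2)%:R.
pose C c1 c2 g0 := \sum_(g1 : gen) p c1 g0 g1 * p c2 g1 g.
(* No step of a path increases [tau], so its ends agree in [tau] exactly when both steps preserve
   it; the homotopical composite is then the full one, and zero otherwise. *)
have CE c1 c2 g0 : C c1 c2 g0 = if tau g == tau g0 then kcomp c1 c2 g0 g else 0.
  rewrite /C /kcomp; case: ifP => [/eqP e|/negP e].
    apply: eq_bigr => g1 _; rewrite /p.
    have [-> le1] := pcoef_kcoef c1 g0 g1; have [-> le2] := pcoef_kcoef c2 g1 g.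
    case k1: (kcoef c1 g0 g1); last by rewrite !mul0r.
    case k2: (kcoef c2 g1 g); last by rewrite !mulr0.
    have {}le1 := le1 k1; have {}le2 := le2 k2.
    have -> : tau g1 = tau g by apply: Order.POrderTheory.le_anti; rewrite le2 e le1.
    by rewrite e eqxx.
  rewrite big1 // => g1 _; rewrite /p.
  have [-> _] := pcoef_kcoef c1 g0 g1; have [-> _] := pcoef_kcoef c2 g1 g.
  case: eqP => [e1|_]; last by rewrite andbF mul0r.
  case: eqP => [e2|_]; last by rewrite !andbF mulr0.
  by case: e; rewrite e2 e1.
(* Reorders the sums so that, for a fixed initial generator, the summation is over ordered pairs of
   crossings. *)
have -> : dh (dh f) g = \sum_(g0 : gen) f g0 * \sum_c2 \sum_c1 C c1 c2 g0.
  transitivity (\sum_c2 \sum_(g1 : gen) \sum_c1 \sum_(g0 : gen)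
      f g0 * (p c1 g0 g1 * p c2 g1 g)).
    rewrite ffunE; apply: eq_bigr => c2 _; apply: eq_bigr => g1 _.
    rewrite ffunE mulr_sumr; apply: eq_bigr => c1 _.
    rewrite mulr_sumr; apply: eq_bigr => g0 _.
    by rewrite mulrA mulrC; congr (_ * _); rewrite mulrC.
  transitivity (\sum_c2 \sum_(g0 : gen) \sum_c1 \sum_(g1 : gen)
      f g0 * (p c1 g0 g1 * p c2 g1 g)).
    apply: eq_bigr => c2 _; rewrite exchange_big [RHS]exchange_big.
    by apply: eq_bigr => c1 _; rewrite exchange_big.
  rewrite exchange_big; apply: eq_bigr => g0 _; rewrite mulr_sumr.
  apply: eq_bigr => c2 _; rewrite mulr_sumr; apply: eq_bigr => c1 _.
  by rewrite mulr_sumr.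
rewrite big1 // => g0 _; rewrite sum_sym_F2 ?mulr0 // => [c1 c2|c]; rewrite !CE.
  by rewrite kcompC.
by rewrite kcomp_diag if_same.
Qed.

End Diagram.

Theorem theorem1 (T : finType) (sg al : {perm T}) (Dd Over : {set T}) :
  is_surface_map sg al ->
  is_diagram sg al Dd Over ->
  admits_source_sink sg al Dd ->
  forall (f : chain sg al Dd Over) (g : gen sg al Dd Over),
    dh (dh f) g = 0%R.
Proof. by case=> _ alK _ _ diagP [Out outP] f g; apply: (dh_dh alK diagP outP). Qed.
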